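(* Let $\Omega\subset\mathbb{R}^3$ be a convex polyhedron, $\mu>0$, $\mu_{NL}>0$, $\alpha\in(-1,\tfrac12)$, write $\omega_\alpha=\operatorname{dist}(\cdot,\partial\Omega)^\alpha$, and let $\mathbf{f}\in\mathbf{L}^2(\Omega)+\mathbf{L}^{3/2}(\operatorname{dist}(\cdot,\partial\Omega)^{-\alpha/2},\Omega)$ (matrix valued). Set $\mathbb{S}(x,\mathbf{Q}^s)=2\left(\mu+\mu_{NL}\operatorname{dist}(x,\partial\Omega)^\alpha|\mathbf{Q}^s|\right)\mathbf{Q}^s$. Let $(\mathbf{u},\mathsf{p})\in\mathbf{X}_3(\omega_\alpha)\times M_3(\omega_\alpha)$ solve $$\int_\Omega\mathbb{S}(x,\boldsymbol{\varepsilon}(\mathbf{u})):\boldsymbol{\varepsilon}(\mathbf{v})\,dx-\int_\Omega\mathsf{p}\operatorname{div}\mathbf{v}\,dx=\int_\Omega\mathbf{f}:\nabla\mathbf{v}\,dx\ \ \forall\mathbf{v}\in\mathbf{X}_3(\omega_\alpha),\qquad\int_\Omega\operatorname{div}\mathbf{u}\,r\,dx=0\ \ \forall r\in M_3(\omega_\alpha),$$ and let $(\mathbf{u}_h,\mathsf{p}_h)\in\mathbf{X}_h\times M_h$ be its finite element approximation, i.e. $$\int_\Omega\mathbb{S}(x,\boldsymbol{\varepsilon}(\mathbf{u}_h)):\boldsymbol{\varepsilon}(\mathbf{v}_h)\,dx-\int_\Omega\mathsf{p}_h\operatorname{div}\mathbf{v}_h\,dx=\int_\Omega\mathbf{f}:\nabla\mathbf{v}_h\,dx\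 \ \forall\mathbf{v}_h\in\mathbf{X}_h,\qquad\int_\Omega\operatorname{div}\mathbf{u}_h\,r_h\,dx=0\ \ \forall r_h\in M_h.$$ Let $(\mathbf{U}_h,P_h)\in\mathbf{X}_h\times M_h$ be the Stokes projection of $(\mathbf{u},\mathsf{p})$. Then $$\|\boldsymbol{\varepsilon}(\mathbf{u}-\mathbf{u}_h)\|_{\mathbf{L}^2(\Omega)}^2+\|\boldsymbol{\varepsilon}(\mathbf{u}-\mathbf{u}_h)\|_{\mathbf{L}^3(\omega_\alpha,\Omega)}^3\le C\left(\|\boldsymbol{\varepsilon}(\mathbf{u}-\mathbf{U}_h)\|_{\mathbf{L}^2(\Omega)}^2+\|\boldsymbol{\varepsilon}(\mathbf{u}-\mathbf{U}_h)\|_{\mathbf{L}^3(\omega_\alpha,\Omega)}^{3/2}\right),$$ where the constant $C$ (which may depend on the problem data, such as $\mathbf{f}$) is independent of $\mathbf{u}$, $\mathsf{p}$, $h$, and $(\mathbf{U}_h,P_h)$.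
   Context: Muckenhoupt weights. A weight is an a.e. positive function in $L^1_{\rm loc}(\mathbb{R}^3)$. For $q\in(1,\infty)$, $\omega\in A_q$ if $[\omega]_{A_q}=\sup_B\left(\frac1{|B|}\int_B\omega\,dx\right)\left(\frac1{|B|}\int_B\omega^{1/(1-q)}dx\right)^{q-1}<\infty$, the supremum over all balls $B\subset\mathbb{R}^3$. $q'$ is the Hölder conjugate of $q$ and $\omega'=\omega^{1/(1-q)}$ (so for $q=3$, $q'=3/2$ and $\omega_\alpha'=\operatorname{dist}(\cdot,\partial\Omega)^{-\alpha/2}$). $L^q(\omega,\Omega)$ is the $L^q$ space with respect to $\omega\,dx$, $\mathring{L}^q(\omega,\Omega)$ its zero-average subspace, $\mathbf{W}^{1,q}_0(\omega,\Omega)$ the corresponding weighted Sobolev space with zero trace. Boldface denotes vector or tensor valued objects; $\boldsymbol{\varepsilon}(\mathbf{v})=\frac12(\nabla\mathbf{v}+\nabla\mathbf{v}^\intercal)$. The spaces are $\mathbf{X}_q(\omega)=\mathbf{W}^{1,2}_0(\Omega)\cap\mathbf{W}^{1,q}_0(\omega,\Omega)$ and $M_q(\omega)=\mathring{L}^2(\Omega)+\mathring{L}^{q'}(\omega',\Omega)$. Finite elements. For every $h>0$, $\mathscr{T}_h$ is a quasiuniform triangulation of $\Omega$ of size $h$ and $\mathbf{X}_h\subset\mathbf{W}^{1,\infty}_0(\Omega)$, $M_h\subset L^\infty(\Omega)\cap\mathring{L}^2(\Omega)$ are finite dimensional spaces of piecewise polynomials (of fixed degree) over $\mathscr{T}_h$.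 All constants below are independent of $h$. For every $q\in(1,\infty)$ and $\omega\in A_q$ they satisfy $$\|p_h\|_{L^{q'}(\omega',\Omega)}\lesssim\sup_{\mathbf{0}\ne\mathbf{v}_h\in\mathbf{X}_h}\frac{\int_\Omega p_h\operatorname{div}\mathbf{v}_h\,dx}{\|\nabla\mathbf{v}_h\|_{\mathbf{L}^q(\omega,\Omega)}}\quad\forall p_h\in M_h .$$ They have the usual approximation properties over quasiuniform meshes, and there is a stable operator $\mathcal{I}_h:\mathbf{L}^1(\Omega)\to\mathbf{X}_h$ that is the identity on $\mathbf{X}_h$ and satisfies $\|\mathbf{v}-\mathcal{I}_h\mathbf{v}\|_{\mathbf{L}^\infty(\Omega)}\lesssim h^{1/2}\|\mathbf{v}\|_{\mathbf{W}^{2,2}(\Omega)}$ for $\mathbf{v}\in\mathbf{W}^{1,2}_0(\Omega)\cap\mathbf{W}^{2,2}(\Omega)$, and, for $q\in(1,\infty)$, $\omega\in A_q$, $\|\nabla(\mathbf{v}-\mathcal{I}_h\mathbf{v})\|_{\mathbf{L}^q(\omega,\Omega)}\lesssim\inf_{\mathbf{v}_h\in\mathbf{X}_h}\|\nabla(\mathbf{v}-\mathbf{v}_h)\|_{\mathbf{L}^q(\omega,\Omega)}$ for $\mathbf{v}\in\mathbf{W}^{1,q}_0(\omega,\Omega)$. Stokes projection. Given $(\mathbf{u},p)\in\mathbf{W}^{1,1}_0(\Omega)\times\mathring{L}^1(\Omega)$ with $\operatorname{div}\mathbf{u}=0$, its Stokes projection is the pair $(\mathbf{U}_h,P_h)\in\mathbf{X}_h\times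 M_h$ with $2\mu\int_\Omega\boldsymbol{\varepsilon}(\mathbf{u}-\mathbf{U}_h):\boldsymbol{\varepsilon}(\mathbf{v}_h)\,dx-\int_\Omega(p-P_h)\operatorname{div}\mathbf{v}_h\,dx=0$ for all $\mathbf{v}_h\in\mathbf{X}_h$ and $\int_\Omega\operatorname{div}(\mathbf{u}-\mathbf{U}_h)\,r_h\,dx=0$ for all $r_h\in M_h$. *)

(* Defs.v *)
From HB Require Import structures.
From mathcomp Require Import all_boot all_order all_algebra.
From mathcomp Require Import all_classical all_reals all_analysis.

Set Implicit Arguments.
Unset Strict Implicit.
Unset Printing Implicit Defensive.

Import Order.TTheory GRing.Theory Num.Theory.
Import numFieldNormedType.Exports.

Local Open Scope classical_set_scope.
Local Open Scope ring_scope.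

(* The physical space R^3, as a product so as to carry the product Lebesgue   *)
(* measure. The norm that MathComp-Analysis puts on a product is the sup norm *)
(* (it is used only for the topology); [enorm] is the Euclidean one.          *)
Notation pt R := (R * R * R)%type.
(* The same type, carrying the product of the Borel sigma-algebras. *)
Notation mpt R :=
  (measurableTypeR R * measurableTypeR R * measurableTypeR R)%type.
Notation vec R := 'rV[R]_3.
Notation mat R := 'M[R]_3.

(* A vector field bundled with a representative of its weak gradient. That    *)
(* [vgrad] is the weak gradient of [vval] is required by [W11] below, which   *)
(* all the Sobolev spaces include; (vgrad v x) i j is the derivative of the   *)
(* i-th component in direction j.                                             *)
Record vfield (R : realType) :=
  VField { vval : pt R -> vec R ; vgrad : pt R -> mat R }.

Section Defs.
Variable R : realType.
Implicit Types (Om : set (pt R)) (x y : pt R) (q : R) (w : pt R -> R).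
Implicit Types (g p : pt R -> R) (v : vfield R) (i j k : 'I_3).

Definition xyz x i : R := nth 0 [:: x.1.1; x.1.2; x.2] i.
Definition e_ j : pt R :=
  ((j == 0 :> nat)%:R, (j == 1 :> nat)%:R, (j == 2 :> nat)%:R).

Definition pdot x y : R := \sum_i xyz x i * xyz y i.
Definition enorm x : R := Num.sqrt (pdot x x).
Definition eball x (r : R) : set (pt R) := [set y | enorm (y - x) < r].

Definition mu3 : {measure set (mpt R) -> \bar R} :=
  (@lebesgue_measure R \x @lebesgue_measure R \x @lebesgue_measure R)%E.

Definition boundary Om : set (pt R) := closure Om `\` interior Om.
Definition dist_bd Om x : R := inf [set enorm (x - y) | y in boundary Om].

Definition convex_polyhedron Om :=
  [/\ Om !=set0, bounded_set Om &
      exists n (a : 'I_n -> pt R) (b : 'I_n -> R),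
        Om = [set x | forall l, pdot (a l) x < b l]].

Definition mdot m n (A B : 'M[R]_(m, n)) : R := \sum_i \sum_j A i j * B i j.
Definition mnorm m n (A : 'M[R]_(m, n)) : R := Num.sqrt (mdot A A).
Definition sym (A : mat R) : mat R := 2^-1 *: (A + A^T).
Definition div v x : R := \tr (vgrad v x).
Definition eps v x : mat R := sym (vgrad v x).

Definition lnorm Om q w g : \bar R :=
  ((\int[mu3]_(x in Om) (`|g x| `^ q * w x)%:E) `^ q^-1)%E.
Definition linfnorm Om g : \bar R := 'N[mu3]_+oo[(EFin \o g) \_ Om]%E.

Definition Lq Om q w : set (pt R -> R) :=
  [set g | measurable_fun (Om : set (mpt R)) (g : mpt R -> R) /\
           (lnorm Om q w g < +oo)%E].
Definition Linf Om : set (pt R -> R) :=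
  [set g | measurable_fun (Om : set (mpt R)) (g : mpt R -> R) /\
           (linfnorm Om g < +oo)%E].
Definition one_w : pt R -> R := cst 1.

Definition tLq m n Om q w : set (pt R -> 'M[R]_(m, n)) :=
  [set F | forall (i : 'I_m) (j : 'I_n), Lq Om q w (fun x => F x i j)].
Definition tnorm m n Om q w (F : pt R -> 'M[R]_(m, n)) : \bar R :=
  lnorm Om q w (fun x => mnorm (F x)).

(* The zero-average subspace; for the weights of interest the weighted space  *)
(* is contained in L^1, so that the average is meaningful.                    *)
Definition Lq0 Om q w : set (pt R -> R) :=
  [set g | [/\ Lq Om q w g, Lq Om 1 one_w g & \int[mu3]_(x in Om) g x = 0]].

Definition sum_space (T : Type) (V : zmodType) (D : set T)
    (E F : set (T -> V)) : set (T -> V) :=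
  [set g : T -> V | exists g1 g2 : T -> V,
     [/\ E g1, F g2 & forall x : T, D x -> g x = g1 x + g2 x]].

Definition weight w :=
  [/\ measurable_fun [set: mpt R] (w : mpt R -> R),
      {ae mu3, forall x, 0 < w x} &
      forall c r, mu3.-integrable (eball c r) (EFin \o w)].

Definition average (B : set (pt R)) g : \bar R :=
  ((fine (mu3 B))^-1%:E * \int[mu3]_(x in B) (g x)%:E)%E.

Definition conj_exp q : R := q / (q - 1).
Definition dual_weight q w x : R := w x `^ (1 - q)^-1.

Definition Aq_const q w : \bar R :=
  ereal_sup [set t | exists c r, 0 < r /\
    t = (average (eball c r) w *
         average (eball c r) (dual_weight q w) `^ (q - 1))%E].

Definition Aq q : set (pt R -> R) :=
  [set w | weight w /\ (Aq_const q w < +oo)%E].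

Definition pderiv j g x : R := 'D_(e_ j) g x.

Definition smooth g := forall s : seq 'I_3,
  let g' := foldr pderiv g s in
  continuous (g' : pt R -> R) /\ forall j x, derivable g' x (e_ j).

Definition test_fun Om : set (pt R -> R) :=
  [set phi | smooth phi /\ exists K : set (pt R),
     [/\ compact K, K `<=` Om & forall x, ~ K x -> phi x = 0]].

Definition weak_pderiv Om j g g' :=
  [/\ Lq Om 1 one_w g, Lq Om 1 one_w g' &
      forall phi, test_fun Om phi ->
        \int[mu3]_(x in Om) (g x * pderiv j phi x) =
        - \int[mu3]_(x in Om) (g' x * phi x)].

Definition W11 Om : set (vfield R) :=
  [set v | forall i j, weak_pderiv Om j
     (fun x => vval v x 0 i) (fun x => vgrad v x i j)].

Definition of_test (phi : 'I_3 -> pt R -> R) : vfield R :=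
  VField (fun x => \row_i phi i x) (fun x => \matrix_(i, j) pderiv j (phi i) x).

Definition W11_0 Om : set (vfield R) :=
  [set v | W11 Om v /\ forall e : R, 0 < e -> exists phi,
     (forall i, test_fun Om (phi i)) /\
     (tnorm Om 1 one_w (fun x => (vval v x - vval (of_test phi) x)%R) +
      tnorm Om 1 one_w (fun x => (vgrad v x - vgrad (of_test phi) x)%R) < e%:E)%E].

(* On a bounded domain L^q(w) is contained in L^1 when w is an A_q weight,    *)
(* hence W^{1,q}(w) is contained in W^{1,1}: having zero trace means lying in *)
(* W^{1,1}_0. This also covers q = +oo, where smooth functions are not dense. *)
Definition W1q_0 Om q w : set (vfield R) :=
  [set v | [/\ W11_0 Om v, tLq Om q w (vval v) & tLq Om q w (vgrad v)]].

Definition W1inf_0 Om : set (vfield R) :=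
  [set v | [/\ W11_0 Om v, forall i, Linf Om (fun x => vval v x 0 i) &
              forall i j, Linf Om (fun x => vgrad v x i j)]].

(* D k x is the derivative in direction k of vgrad v at x *)
Definition W22 Om v (D : 'I_3 -> pt R -> mat R) :=
  [/\ W11 Om v, tLq Om 2 one_w (vval v), tLq Om 2 one_w (vgrad v),
      forall i j k, weak_pderiv Om k (fun x => vgrad v x i j)
                                     (fun x => D k x i j) &
      forall k, tLq Om 2 one_w (D k)].

Definition W22_norm Om v (D : 'I_3 -> pt R -> mat R) : \bar R :=
  lnorm Om 2 one_w (fun x => Num.sqrt (mnorm (vval v x) ^+ 2 +
    mnorm (vgrad v x) ^+ 2 + \sum_k mnorm (D k x) ^+ 2)).

Definition W12_scalar Om p (dp : 'I_3 -> pt R -> R) :=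
  Lq Om 2 one_w p /\
  forall j, weak_pderiv Om j p (dp j) /\ Lq Om 2 one_w (dp j).

Definition W12_norm Om p (dp : 'I_3 -> pt R -> R) : \bar R :=
  lnorm Om 2 one_w (fun x => Num.sqrt (p x ^+ 2 + \sum_j dp j x ^+ 2)).

Definition Xspace Om q w : set (vfield R) :=
  W1q_0 Om 2 one_w `&` W1q_0 Om q w.

Definition Mspace Om q w : set (pt R -> R) :=
  sum_space Om (Lq0 Om 2 one_w) (Lq0 Om (conj_exp q) (dual_weight q w)).

Definition hull (P : 'I_4 -> pt R) (J : {set 'I_4}) : set (pt R) :=
  [set x | exists l : 'I_4 -> R,
     [/\ forall a, 0 <= l a, forall a, a \notin J -> l a = 0,
         \sum_a l a = 1 & forall i, xyz x i = \sum_a l a * xyz (P a) i]].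

Definition affinely_independent (P : 'I_4 -> pt R) :=
  forall l : 'I_4 -> R, \sum_a l a = 0 ->
    (forall i, \sum_a l a * xyz (P a) i = 0) -> forall a, l a = 0.

Definition tetrahedron (K : set (pt R)) :=
  exists2 P, affinely_independent P & K = hull P [set: 'I_4].

(* the empty set is a face, obtained for J = set0 *)
Definition face (F K : set (pt R)) :=
  exists P, [/\ affinely_independent P, K = hull P [set: 'I_4] &
    exists J, F = hull P J].

Definition triangulation Om (T : set (set (pt R))) :=
  [/\ finite_set T, forall K, T K -> tetrahedron K,
      \bigcup_(K in T) K = closure Om &
      forall K K', T K -> T K' -> face (K `&` K') K /\ face (K `&` K') K'].

(* H is the set of mesh sizes: for large h a bounded domain has no            *)
(* quasiuniform triangulation of size h, so that H cannot be all of h > 0.    *)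
Definition quasiuniform Om (H : set R) (T : R -> set (set (pt R))) :=
  exists c : R, 0 < c /\ forall h, H h ->
    triangulation Om (T h) /\
    forall K, T h K ->
      (forall x y, K x -> K y -> enorm (x - y) <= h) /\
      exists x, eball x (c * h) `<=` K.

Definition poly_fun (d : nat) g :=
  exists a : 'I_d.+1 -> 'I_d.+1 -> 'I_d.+1 -> R,
    forall x, g x = \sum_(l < d.+1) \sum_(m < d.+1)
      \sum_(n < d.+1 | (l + m + n <= d)%N)
        a l m n * xyz x 0 ^+ l * xyz x 1 ^+ m * xyz x 2 ^+ n.

Definition piecewise_poly (T : set (set (pt R))) (d : nat) g :=
  forall K, T K -> exists2 P, poly_fun d P &
    forall x, interior K x -> g x = P x.

Definition lincomb n (c : 'I_n -> R) (b : 'I_n -> vfield R) : vfield R :=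
  VField (fun x => \sum_l c l *: vval (b l) x)
         (fun x => \sum_l c l *: vgrad (b l) x).

Definition velocity_spaces Om (H : set R) (T : R -> set (set (pt R)))
    (X : R -> set (vfield R)) :=
  exists d : nat, forall h, H h ->
    [/\ exists n (b : 'I_n -> vfield R), X h = [set lincomb c b | c in setT],
        X h `<=` W1inf_0 Om &
        forall v, X h v ->
          forall i, piecewise_poly (T h) d (fun x => vval v x 0 i)].

Definition pressure_spaces Om (H : set R) (T : R -> set (set (pt R)))
    (M : R -> set (pt R -> R)) :=
  exists d : nat, forall h, H h ->
    [/\ exists n (b : 'I_n -> pt R -> R),
          M h = [set (fun x => \sum_l c l * b l x) | c in setT],
        M h `<=` Linf Om `&` Lq0 Om 2 one_w &
        forall p, M h p -> piecewise_poly (T h) d p].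

Definition nonzero Om : set (vfield R) :=
  [set v | ~ {ae mu3, forall x, Om x -> vval v x = 0}].

Definition inf_sup Om (H : set R) (X : R -> set (vfield R))
    (M : R -> set (pt R -> R)) :=
  forall q w, 1 < q -> Aq q w -> exists C : R, 0 < C /\
    forall h, H h -> forall p, M h p ->
      (lnorm Om (conj_exp q) (dual_weight q w) p <=
       C%:E * ereal_sup
         [set (\int[mu3]_(x in Om) (p x * div v x)
               / fine (tnorm Om q w (vgrad v)))%R%:E
         | v in X h `&` nonzero Om])%E.

(* The first order estimates are the ones common to all the usual pairs.      *)
Definition approx_property Om (H : set R) (X : R -> set (vfield R))
    (M : R -> set (pt R -> R)) :=
  exists C : R, 0 < C /\ forall h, H h ->
    (forall v D, W1q_0 Om 2 one_w v -> W22 Om v D ->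
       exists2 z, X h z &
         (tnorm Om 2 one_w (fun x => (vgrad v x - vgrad z x)%R) <=
          (C * h)%:E * W22_norm Om v D)%E) /\
    (forall p dp, Lq0 Om 2 one_w p -> W12_scalar Om p dp ->
       exists2 r, M h r &
         (lnorm Om 2 one_w (fun x => (p x - r x)%R) <=
          (C * h)%:E * W12_norm Om p dp)%E).

(* Ih h acts on representatives; the second clause makes it an operator on    *)
(* classes modulo a.e. equality.                                              *)
Definition projection_onto Om (H : set R) (X : R -> set (vfield R))
    (Ih : R -> (pt R -> vec R) -> vfield R) :=
  forall h, H h ->
  [/\ forall z, tLq Om 1 one_w z -> X h (Ih h z),
      forall z z', tLq Om 1 one_w z -> tLq Om 1 one_w z' ->
        {ae mu3, forall x, Om x -> z x = z' x} ->
        {ae mu3, forall x, Om x -> vval (Ih h z) x = vval (Ih h z') x} &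
      forall v, X h v -> {ae mu3, forall x, Om x ->
        vval (Ih h (vval v)) x = vval v x /\
        vgrad (Ih h (vval v)) x = vgrad v x}].

Definition interpolation Om (H : set R) (X : R -> set (vfield R))
    (Ih : R -> (pt R -> vec R) -> vfield R) :=
  [/\ projection_onto Om H X Ih,
      exists C : R, 0 < C /\ forall h, H h -> forall z, tLq Om 1 one_w z ->
        (tnorm Om 1 one_w (vval (Ih h z)) <= C%:E * tnorm Om 1 one_w z)%E,
      exists C : R, 0 < C /\ forall h, H h ->
        forall v D, W1q_0 Om 2 one_w v -> W22 Om v D ->
          (linfnorm Om (fun x => mnorm (vval v x - vval (Ih h (vval v)) x)%R) <=
           (C * Num.sqrt h)%:E * W22_norm Om v D)%E &
      forall q w, 1 < q -> Aq q w -> exists C : R, 0 < C /\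
        forall h, H h -> forall v, W1q_0 Om q w v ->
          (tnorm Om q w (fun x => (vgrad v x - vgrad (Ih h (vval v)) x)%R) <=
           C%:E * ereal_inf
             [set tnorm Om q w (fun x => (vgrad v x - vgrad z x)%R)
             | z in X h])%E].

Record fe_discretization Om (H : set R) (T : R -> set (set (pt R)))
    (X : R -> set (vfield R)) (M : R -> set (pt R -> R))
    (Ih : R -> (pt R -> vec R) -> vfield R) : Prop := {
  fe_sizes : forall h, H h -> 0 < h ;
  fe_mesh : quasiuniform Om H T ;
  fe_velocity : velocity_spaces Om H T X ;
  fe_pressure : pressure_spaces Om H T M ;
  fe_inf_sup : inf_sup Om H X M ;
  fe_approx : approx_property Om H X M ;
  fe_interpolation : interpolation Om H X Ih }.

Definition dist_weight Om (alpha : R) x : R := dist_bd Om x `^ alpha.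

Definition stress Om (mu muNL alpha : R) x (Q : mat R) : mat R :=
  (2 * (mu + muNL * dist_weight Om alpha x * mnorm Q)) *: Q.

(* The continuous problem for (X, M) = (X_3, M_3), the discrete one for       *)
(* (X, M) = (X_h, M_h).                                                       *)
Definition smagorinsky_sol Om (mu muNL alpha : R) (f : pt R -> mat R)
    (X : set (vfield R)) (M : set (pt R -> R)) (u : vfield R) p :=
  [/\ X u, M p,
      forall v, X v ->
        \int[mu3]_(x in Om) mdot (stress Om mu muNL alpha x (eps u x)) (eps v x)
        - \int[mu3]_(x in Om) (p x * div v x)
        = \int[mu3]_(x in Om) mdot (f x) (vgrad v x) &
      forall r, M r -> \int[mu3]_(x in Om) (div u x * r x) = 0].

Definition stokes_projection Om (mu : R) (X : set (vfield R))
    (M : set (pt R -> R)) (u : vfield R) p (U : vfield R) P :=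
  [/\ X U, M P,
      forall v, X v ->
        2 * mu * (\int[mu3]_(x in Om) mdot (eps u x - eps U x) (eps v x))
        - \int[mu3]_(x in Om) ((p x - P x) * div v x) = 0 &
      forall r, M r -> \int[mu3]_(x in Om) ((div u x - div U x) * r x) = 0].

End Defs.

Arguments one_w {R}.

(* Main.v *)
(* Testing the momentum equation with u, and its discrete analogue with u_h,
   bounds eps(u) and eps(u_h) in L^3(omega_alpha). Korn's inequality is avoided
   by writing f : grad v, through the equation of one fixed solution (u0, p0)
   for the same data, as S(eps(u0)) : eps(v) - p0 div v; the bound depends on f
   through (u0, p0).

   With v_h = U_h - u_h, which is discretely divergence free, Galerkin
   orthogonality and the definition of the Stokes projection give
     int (S(eps(u)) - S(eps(u_h))) : eps(v_h)
       = 2 mu int eps(u - U_h) : eps(v_h),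
   and the strong monotonicity of Q |-> |Q| Q together with
     a z y <= (s^3 a^3 + z^3 / 8 + 8 y^3 / s^3) / 3
   (a = |eps(u)| or |eps(u_h)|, z = |eps(u - u_h)|, y = |eps(u - U_h)|) yields
   the estimate upon choosing s^6 = int omega_alpha |eps(u - U_h)|^3.

   Testing the continuous problem with discrete functions requires omega_alpha
   to be integrable: the layer {dist(., bd Om) <= r} is covered by one slab of
   width O(r) per face, hence has measure O(r), and dist^alpha is summed over
   dyadic layers. *)
Require Import Defs.
From mathcomp Require Import all_boot all_order all_algebra.
From mathcomp Require Import all_classical all_reals all_analysis.
From mathcomp Require Import measurable_realfun ess_sup_inf hoelder ring lra.

Set Implicit Arguments.
Unset Strict Implicit.
Unset Printing Implicit Defensive.

Import Order.TTheory GRing.Theory Num.Theory.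
Import numFieldNormedType.Exports.

Local Open Scope classical_set_scope.
Local Open Scope ring_scope.

(** $x^3+y^3+z^3-3xyz$ is half of $(x+y+z)\left((x-y)^2+(y-z)^2+(z-x)^2\right)$. *)
Lemma amgm3 (R : realType) (x y z : R) : 0 <= x -> 0 <= y -> 0 <= z ->
  x * y * z <= (x ^+ 3 + y ^+ 3 + z ^+ 3) / 3.
Proof.
move=> x0 y0 z0; rewrite ler_pdivlMr//.
have : 0 <= (x + y + z) * ((x - y) ^+ 2 + (y - z) ^+ 2 + (z - x) ^+ 2).
  by rewrite mulr_ge0 ?addr_ge0 ?sqr_ge0.
by nra.
Qed.

(** * Frobenius product and the Smagorinsky law *)

Section frobenius.
Variables (R : realType) (m n : nat).
Implicit Types A B C : 'M[R]_(m, n).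

Lemma mdotC A B : mdot A B = mdot B A.
Proof. by apply: eq_bigr => i _; apply: eq_bigr => j _; rewrite mulrC. Qed.

Lemma mdotDl A B C : mdot (A + B) C = mdot A C + mdot B C.
Proof.
rewrite -big_split/=; apply: eq_bigr => i _; rewrite -big_split/=.
by apply: eq_bigr => j _; rewrite mxE mulrDl.
Qed.

Lemma mdotZl a A B : mdot (a *: A) B = a * mdot A B.
Proof.
rewrite mulr_sumr; apply: eq_bigr => i _; rewrite mulr_sumr.
by apply: eq_bigr => j _; rewrite mxE mulrA.
Qed.

Lemma mdotBl A B C : mdot (A - B) C = mdot A C - mdot B C.
Proof. by rewrite mdotDl -scaleN1r mdotZl mulN1r. Qed.

Lemma mdotBr A B C : mdot C (A - B) = mdot C A - mdot C B.
Proof. by rewrite !(mdotC C) mdotBl. Qed.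

Lemma mdot_ge0 A : 0 <= mdot A A.
Proof. by do 2!apply: sumr_ge0 => ? _; rewrite -expr2 sqr_ge0. Qed.

Lemma mnorm_ge0 A : 0 <= mnorm A.
Proof. exact: sqrtr_ge0. Qed.

Lemma mnorm_sqr A : mnorm A ^+ 2 = mdot A A.
Proof. by rewrite sqr_sqrtr ?mdot_ge0. Qed.

(** Cauchy-Schwarz: the square norm of $(B:B)A-(A:B)B$ is $B:B$ times the gap between the two
    squared sides. The division by $B:B$ leaves the case where all entries of $B$ vanish. *)
Lemma mdot_le_mnorm A B : `|mdot A B| <= mnorm A * mnorm B.
Proof.
rewrite -ler_sqr ?nnegrE ?mulr_ge0 ?mnorm_ge0// exprMn !mnorm_sqr.
rewrite real_normK ?num_real//.
have [B0|B0] := eqVneq (mdot B B) 0.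
  suff -> : mdot A B = 0 by rewrite expr0n mulr_ge0 ?mdot_ge0.
  rewrite /mdot big1// => i _; rewrite big1// => j _.
  have /eqP := B0; rewrite psumr_eq0; last first.
    by move=> k _; apply: sumr_ge0 => l _; rewrite -expr2 sqr_ge0.
  move=> /allP/(_ i); rewrite mem_index_enum => /(_ isT)/=.
  rewrite psumr_eq0; last by move=> l _; rewrite -expr2 sqr_ge0.
  move=> /allP/(_ j); rewrite mem_index_enum => /(_ isT)/=.
  by rewrite mulf_eq0 orbb => /eqP ->; rewrite mulr0.
have := mdot_ge0 (mdot B B *: A - mdot A B *: B).
rewrite mdotBl !mdotBr !(mdotZl, mdotC A (_ *: _), mdotC B (_ *: _)).
rewrite (mdotC B A) => H.
have Bp : 0 < mdot B B by rewrite lt_def B0 mdot_ge0.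
by rewrite -(ler_pM2l Bp); lra.
Qed.

Lemma mnormB_sqr A B :
  mnorm (A - B) ^+ 2 = mnorm A ^+ 2 + mnorm B ^+ 2 - 2 * mdot A B.
Proof. by rewrite !mnorm_sqr mdotBl !mdotBr (mdotC B A); ring. Qed.

Lemma mnormB A B : mnorm (A - B) <= mnorm A + mnorm B.
Proof.
rewrite -ler_sqr ?nnegrE ?addr_ge0 ?mnorm_ge0// mnormB_sqr.
have := mdot_le_mnorm A B; rewrite ler_norml => /andP[+ _].
by nra.
Qed.

Lemma mnorm_le_sum A : mnorm A <= \sum_i \sum_j `|A i j|.
Proof.
have s0 i : 0 <= \sum_j `|A i j| by apply: sumr_ge0.
rewrite -ler_sqr ?nnegrE ?mnorm_ge0//; last by apply: sumr_ge0.
rewrite mnorm_sqr [leRHS]expr2 mulr_suml; apply: ler_sum => i _.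
apply: (@le_trans _ _ ((\sum_j `|A i j|) * (\sum_j `|A i j|))).
  rewrite mulr_suml; apply: ler_sum => j _.
  rewrite (le_trans (ler_norm _))// normrM ler_wpM2l//.
  by rewrite (bigD1 j)//= lerDl sumr_ge0.
rewrite ler_wpM2l// (bigD1 i)//= lerDl; exact: sumr_ge0.
Qed.

(** With $x=|A|$, $y=|B|$, $z=|A-B|$, eliminating $A:B$ by polarization turns the right side into
    $\frac12(x+y)(x-y)^2+\frac12(x+y)z^2$, and $x+y\ge z$. *)
Lemma mdot_cubic_monotone A B :
  mnorm (A - B) ^+ 3 / 2 <= mdot (mnorm A *: A - mnorm B *: B) (A - B).
Proof.
have := mnormB_sqr A B; have := mnormB A B.
rewrite mdotBl !mdotBr !mdotZl (mdotC B A) -!mnorm_sqr.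
move: (mnorm_ge0 A) (mnorm_ge0 B) (mnorm_ge0 (A - B)).
move: (mnorm A) (mnorm B) (mnorm (A - B)) (mdot A B) => x y z d x0 y0 z0 h1 h2.
have h3 : 0 <= (x + y) * (x - y) ^+ 2 by rewrite mulr_ge0 ?addr_ge0 ?sqr_ge0.
have h4 : 0 <= z ^+ 2 * (x + y - z) by rewrite mulr_ge0 ?sqr_ge0 ?subr_ge0.
have -> : d = (x ^+ 2 + y ^+ 2 - z ^+ 2) / 2 by rewrite h2; field.
by nra.
Qed.

Lemma mnorm_triangle_rev A B : `|mnorm A - mnorm B| <= mnorm (A - B).
Proof.
rewrite -ler_sqr ?nnegrE ?mnorm_ge0// real_normK ?num_real// mnormB_sqr.
have := le_trans (ler_norm _) (mdot_le_mnorm A B); nra.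
Qed.

Lemma mdot_cubic_lipschitz A B E :
  `|mdot (mnorm A *: A - mnorm B *: B) E| <=
  (mnorm A + mnorm B) * mnorm (A - B) * mnorm E.
Proof.
have -> : mnorm A *: A - mnorm B *: B =
    mnorm A *: (A - B) - (mnorm B - mnorm A) *: B.
  by rewrite scalerBr scalerBl opprB addrA subrK.
rewrite mdotBl !mdotZl (le_trans (ler_normB _ _))// !normrM.
rewrite (ger0_norm (mnorm_ge0 A)) distrC.
have := mnorm_triangle_rev A B; have := mdot_le_mnorm (A - B) E.
have := mdot_le_mnorm B E.
have := mnorm_ge0 A; have := mnorm_ge0 B; have := mnorm_ge0 E.
move: (normr_ge0 (mdot B E)) (normr_ge0 (mnorm A - mnorm B)).
move: `|mdot B E| `|mnorm A - mnorm B| `|mdot (A - B) E| => p q r.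
move=> p0 q0 e0 b0 a0 h1 h2 h3.
rewrite 2!mulrDl lerD//; first by rewrite -mulrA ler_wpM2l.
rewrite (le_trans (ler_pM q0 p0 h3 h1))//.
by rewrite mulrA (mulrC (mnorm B)).
Qed.
End frobenius.

Section matrix3.
Variable R : realType.
Implicit Types A B E : mat R.

(** Cauchy-Schwarz against the identity matrix, whose norm $\sqrt3$ is rounded up to 2. *)
Lemma trace_le_mnorm A : `|\tr A| <= 2 * mnorm A.
Proof.
have -> : \tr A = mdot A 1%:M.
  rewrite /mdot/mxtrace; apply: eq_bigr => i _.
  rewrite (bigD1 i)//= mxE eqxx mulr1 big1 ?addr0// => j ji.
  by rewrite mxE eq_sym (negbTE ji) mulr0.
apply: (le_trans (mdot_le_mnorm _ _)); rewrite mulrC ler_wpM2r ?mnorm_ge0//.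
rewrite -ler_sqr ?nnegrE ?mnorm_ge0// mnorm_sqr /mdot.
rewrite !big_ord_recl !big_ord0 !mxE/=; lra.
Qed.

Lemma trace_sym A : \tr (sym A) = \tr A.
Proof. by rewrite /sym mxtraceZ mxtraceD mxtrace_tr; field. Qed.

Lemma symB A B : sym (A - B) = sym A - sym B.
Proof. by rewrite /sym raddfB/= -scalerBr opprD addrACA. Qed.
End matrix3.

(** * Pointwise estimates for the Smagorinsky stress *)

Section smagorinsky_law.
Variables (R : realType) (mu k : R).
Hypotheses (mu0 : 0 < mu) (k0 : 0 < k).
Implicit Types (a b c : mat R) (w s : R).

(** [stress] with the value of the weight as argument in place of the position, so that the
    estimates below are statements about numbers and matrices. *)
Definition smag w a : mat R := (2 * (mu + k * w * mnorm a)) *: a.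

(** Here [a], [b], [c] stand for the symmetric gradients of $u$, $u_h$, $U_h$; the right side is the
    integrand of the error equation. Its linear part is $2\mu|e-g|^2$ with $e=a-b$, $g=a-c$. In its
    cubic part, monotonicity is tested with $e$ and the Lipschitz bound with $g$. The parameter [s]
    stays free, to be optimized after integration. *)
Lemma smag_error w s a b c : 0 <= w -> 0 < s ->
  mu * mnorm (a - b) ^+ 2 - 2 * mu * mnorm (a - c) ^+ 2 +
  2 * k * (w * (5 / 12 * mnorm (a - b) ^+ 3
    - s ^+ 3 * (mnorm a ^+ 3 + mnorm b ^+ 3) / 3
    - 16 / 3 * mnorm (a - c) ^+ 3 / s ^+ 3)) <=
  mdot (smag w a - smag w b - (2 * mu) *: (a - c)) (c - b).
Proof.
move=> w0 s0.
pose e := a - b; pose g := a - c; pose d := mnorm a *: a - mnorm b *: b.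
have -> : c - b = e - g by apply/matrixP => i j; rewrite !mxE; ring.
have -> : smag w a - smag w b - (2 * mu) *: (a - c) =
    (2 * mu) *: (e - g) + (2 * k * w) *: d.
  by apply/matrixP => i j; rewrite /smag /e /g /d !mxE; ring.
rewrite mdotDl !mdotZl -mnorm_sqr (mnormB_sqr e g) (mdotBr e g d).
have := mdot_cubic_monotone a b; have := mdot_cubic_lipschitz a b g.
rewrite -/d -/e -/g => h1 h2.
have {}h1 := le_trans (ler_norm _) h1.
have h3 := le_trans (ler_norm _) (mdot_le_mnorm e g).
have x0 := mnorm_ge0 a; have y0 := mnorm_ge0 b; have z0 := mnorm_ge0 e.
have u0 := mnorm_ge0 g.
move: (mnorm a) (mnorm b) (mnorm e) (mnorm g) (mdot d e) (mdot d g) (mdot e g)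
  x0 y0 z0 u0 h1 h2 h3 => x y z u de dg eg x0 y0 z0 u0 h1 h2 h3.
(* AM-GM for $st$, $z/2$ and $2u/s$. The two uses, $t=x$ and $t=y$, cost $z^3/24$ each, so that
   $5/12$ remains of the $z^3/2$ from monotonicity. *)
have ag t : 0 <= t ->
    t * z * u <= (z ^+ 3 / 8 + s ^+ 3 * t ^+ 3 + 8 * (u ^+ 3 / s ^+ 3)) / 3.
  move=> t0.
  have sn : s != 0 by rewrite gt_eqF.
  have := @amgm3 _ (s * t) (z / 2) (2 * u / s) _ _ _.
  have -> : s * t * (z / 2) * (2 * u / s) = t * z * u by field.
  have -> : (s * t) ^+ 3 + (z / 2) ^+ 3 + (2 * u / s) ^+ 3 =
    z ^+ 3 / 8 + s ^+ 3 * t ^+ 3 + 8 * (u ^+ 3 / s ^+ 3) by field.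
  by apply; rewrite ?mulr_ge0 ?invr_ge0 ?(ltW s0).
have agx := ag _ x0; have agy := ag _ y0.
rewrite -[2 * k * w * _]mulrA; apply: lerD.
  have zu : 0 <= (z - 2 * u) ^+ 2 by rewrite sqr_ge0.
  have : 0 <= mu * (z ^+ 2 + 4 * u ^+ 2 - 4 * eg).
    by rewrite mulr_ge0 ?(ltW mu0)//; lra.
  by lra.
rewrite ler_pM2l ?mulr_gt0// ler_wpM2l//.
rewrite -(mulrA (16 / 3)); move: agx agy h1 h2.
move: (u ^+ 3 / s ^+ 3) (s ^+ 3) => p q.
by rewrite 2!mulrDl; lra.
Qed.
End smagorinsky_law.

Lemma young_sqr (R : realFieldType) (m x y : R) : 0 < m ->
  x * y <= m * y ^+ 2 / 4 + x ^+ 2 / m.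
Proof.
move=> m0; have -> : m * y ^+ 2 / 4 + x ^+ 2 / m = x * y + (m * y / 2 - x) ^+ 2 / m.
  by field; rewrite gt_eqF.
by rewrite lerDl divr_ge0 ?sqr_ge0// ltW.
Qed.

(* Multiplied by [Num.sqrt w], this is AM-GM for [r * r * (Num.sqrt w * y)]
   with [r = Num.sqrt q]. *)
Lemma young_dual (R : realType) (k : R) : 0 < k ->
  exists2 C : R, 0 < C & forall w q y : R, 0 < w -> 0 <= q -> 0 <= y ->
    q * y <= k * w * y ^+ 3 + C * (q `^ conj_exp 3 * w `^ (1 - 3)^-1).
Proof.
(* The choice $t=\min(1,k)$ gives $t^3\le t\le k$, so the cubic term of AM-GM, applied to $r/t$, $r$
   and $t\sqrt w\,y$, fits under $k$. *)
move=> k0; have [t [t0 t1 tk]] : exists t, [/\ 0 < t, t <= 1 & t <= k].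
  by exists (Num.min 1 k); rewrite lt_min ltr01 k0 !ge_min !lexx orbT.
exists (t ^- 3 + 1); first by rewrite addr_gt0 ?ltr01// invr_gt0 exprn_gt0.
move=> w q y w0 q0 y0.
pose r := Num.sqrt q; pose z := Num.sqrt w.
have r0 : 0 <= r by rewrite sqrtr_ge0.
have z0 : 0 < z by rewrite sqrtr_gt0.
have -> : q `^ conj_exp 3 = r ^+ 3.
  by rewrite /r -powR12_sqrt// -powR_mulrn ?powR_ge0// -powRrM; congr powR;
    rewrite /conj_exp; field.
have -> : w `^ (1 - 3)^-1 = z^-1.
  by rewrite /z -powR12_sqrt ?(ltW w0)// -powRN; congr powR; field.
have -> : q = r ^+ 2 by rewrite sqr_sqrtr.
have -> : w = z ^+ 2 by rewrite sqr_sqrtr// ltW.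
have zn : z != 0 by rewrite gt_eqF.
have tn : t != 0 by rewrite gt_eqF.
rewrite -(ler_pM2l z0).
have -> : z * (k * z ^+ 2 * y ^+ 3 + (t ^- 3 + 1) * (r ^+ 3 / z)) =
   k * (z * y) ^+ 3 + (r / t) ^+ 3 + r ^+ 3 by field; rewrite zn tn.
have -> : z * (r ^+ 2 * y) = (r / t) * r * (t * (z * y)) by field.
set Y := z * y; have Y0 : 0 <= Y by rewrite mulr_ge0// ltW.
have rt0 : 0 <= r / t by rewrite divr_ge0// ltW.
have tY0 : 0 <= t * Y by rewrite mulr_ge0// ltW.
apply: (le_trans (amgm3 rt0 r0 tY0)).
have : (t * Y) ^+ 3 <= k * Y ^+ 3.
  rewrite exprMn ler_wpM2r ?exprn_ge0// (le_trans _ tk)// exprS.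
  by rewrite ler_piMr ?(ltW t0)// exprn_ile1// ltW.
move: (exprn_ge0 3 r0) (exprn_ge0 3 rt0) (exprn_ge0 3 tY0); lra.
Qed.

(** The energy of [b] is $2\mu|b|^2+2kw|b|^3$. Its quadratic part absorbs the linear stress of [a]
    and the $L^2$ pressure [q1]. Its cubic part absorbs the nonlinear stress of [a] and, by
    [young_dual], the weighted pressure [q2]: these take $k/12$ and $k/2$, leaving more than $k$. *)
Lemma smag_coercive (R : realType) (mu k : R) : 0 < mu -> 0 < k ->
  exists2 C : R, 0 < C & forall (w q1 q2 : R) (a b : mat R), 0 < w ->
    k * (w * mnorm b ^+ 3) <=
    mdot (smag mu k w b) b - mdot (smag mu k w a) b + (q1 + q2) * \tr b +
    C * (mnorm a ^+ 2 + w * mnorm a ^+ 3 + q1 ^+ 2 +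
         `|q2| `^ conj_exp 3 * w `^ (1 - 3)^-1).
Proof.
move=> mu0 k0; have k4 : 0 < k / 4 by rewrite divr_gt0.
have [C C0 CP] := young_dual k4.
(* One constant covers every cost: $2C$ for the dual term, $2\mu$ for $|a|^2$, $6k$ for $w|a|^3$,
   $4/\mu$ for $q_1^2$. *)
exists (2 * C + 2 * mu + 6 * k + 4 / mu).
  by rewrite !addr_gt0 ?mulr_gt0 ?invr_gt0.
move=> w q1 q2 a b w0.
have x0 := mnorm_ge0 a; have y0 := mnorm_ge0 b.
have ab := le_trans (ler_norm _) (mdot_le_mnorm a b).
have tb := trace_le_mnorm b.
have := CP w `|q2| (mnorm b) w0 (normr_ge0 _) y0.
have G0 : 0 <= `|q2| `^ conj_exp 3 * w `^ (1 - 3)^-1.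
  by rewrite mulr_ge0 ?powR_ge0.
rewrite /smag !mdotZl -mnorm_sqr.
move: (mnorm a) (mnorm b) (mdot a b) (\tr b) (_ * w `^ _) x0 y0 ab tb G0.
move=> x y d t G x0 y0 xy ty G0 hG.
have h1 : 2 * x * y <= y ^+ 2 + x ^+ 2.
  have : 0 <= (x - y) ^+ 2 by rewrite sqr_ge0.
  by lra.
have h2 : x ^+ 2 * y <= 3 * x ^+ 3 + y ^+ 3 / 24.
  have x20 : 0 <= 2 * x by rewrite mulr_ge0.
  have y20 : 0 <= y / 2 by rewrite divr_ge0.
  have := amgm3 x20 x0 y20.
  have -> : 2 * x * x * (y / 2) = x ^+ 2 * y by field.
  by rewrite !exprMn exprVn; lra.
have h3 : - (q1 * t) <= mu * y ^+ 2 + 4 / mu * q1 ^+ 2.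
  have := young_sqr (2 * `|q1|) y mu0; rewrite exprMn real_normK ?num_real//.
  move=> h; apply: (@le_trans _ _ (2 * `|q1| * y)).
    rewrite (le_trans (ler_norm _))// normrN normrM -mulrA mulrCA ler_wpM2l//.
  apply: (le_trans h); have : 0 <= mu * y ^+ 2 by rewrite mulr_ge0 ?sqr_ge0// ltW.
  by rewrite -!mulrA; lra.
have h4 : - (q2 * t) <= 2 * (`|q2| * y).
  by rewrite (le_trans (ler_norm _))// normrN normrM mulrCA ler_wpM2l.
have h5 : 2 * (mu + k * w * x) * d <= 2 * (mu + k * w * x) * (x * y).
  by rewrite ler_wpM2l// mulr_ge0// addr_ge0// ?mulr_ge0// ltW.
have m1 : 0 <= mu * (y ^+ 2 + x ^+ 2 - 2 * x * y).
  by rewrite mulr_ge0 ?subr_ge0// ltW.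
have wk : 0 <= k * w by rewrite mulr_ge0// ltW.
have m2 : 0 <= k * w * (3 * x ^+ 3 + y ^+ 3 / 24 - x ^+ 2 * y).
  by rewrite mulr_ge0 ?subr_ge0.
have p1 : 0 <= mu * y ^+ 2 by rewrite mulr_ge0 ?sqr_ge0// ltW.
have p2 : 0 <= k * w * y ^+ 3 by rewrite mulr_ge0 ?exprn_ge0.
have p3 : 0 <= mu * x ^+ 2 by rewrite mulr_ge0 ?sqr_ge0// ltW.
have p4 : 0 <= mu * (w * x ^+ 3) by rewrite !mulr_ge0 ?exprn_ge0// ltW.
have p5 : 0 <= k * x ^+ 2 by rewrite mulr_ge0 ?sqr_ge0// ltW.
have im : 0 <= mu^-1 by rewrite invr_ge0 ltW.
have p6 : 0 <= mu^-1 * (x ^+ 2 + w * x ^+ 3 + G).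
  by rewrite mulr_ge0// !addr_ge0 ?mulr_ge0 ?exprn_ge0// ltW.
have p7 : 0 <= C * (x ^+ 2 + w * x ^+ 3 + q1 ^+ 2).
  by rewrite mulr_ge0 ?(ltW C0)// !addr_ge0 ?sqr_ge0// mulr_ge0 ?exprn_ge0// ltW.
have p8 : 0 <= (mu + k) * (q1 ^+ 2 + G).
  by rewrite mulr_ge0 ?addr_ge0 ?sqr_ge0// ltW.
have p9 : 0 <= k * (w * x ^+ 3) by rewrite !mulr_ge0 ?exprn_ge0// ltW.
have p10 : 0 <= mu * q1 ^+ 2 by rewrite mulr_ge0 ?sqr_ge0// ltW.
have p11 : 0 <= mu * G by rewrite mulr_ge0// ltW.
have p12 : 0 <= k * q1 ^+ 2 by rewrite mulr_ge0 ?sqr_ge0// ltW.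
have p13 : 0 <= k * G by rewrite mulr_ge0// ltW.
by lra.
Qed.

(** * Weighted energy estimates *)

Section integrability.
Context d (T : measurableType d) (R : realType).
Variables (nu : {measure set T -> \bar R}) (D : set T).
Hypothesis mD : measurable D.
Implicit Types f g : T -> R.

Definition Rintegrable f := nu.-integrable D (EFin \o f).

Lemma Rintegrable_le f g : measurable_fun D f -> Rintegrable g ->
  (forall x, D x -> `|f x| <= g x) -> Rintegrable f.
Proof.
move=> mf ig fg; apply: (le_integrable mD _ _ ig); first exact/measurable_EFinP.
by move=> x Dx /=; rewrite lee_fin (le_trans (fg _ Dx))// ler_norm.
Qed.

Lemma RintegrableD f g :
  Rintegrable f -> Rintegrable g -> Rintegrable (fun x => f x + g x).
Proof. by move=> hf hg; exact: (integrableD mD hf hg). Qed.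

Lemma RintegrableZ a f : Rintegrable f -> Rintegrable (fun x => a * f x).
Proof. by move=> hf; exact: (integrableZl mD a hf). Qed.

Lemma RintegrableB f g :
  Rintegrable f -> Rintegrable g -> Rintegrable (fun x => f x - g x).
Proof. by move=> hf hg; exact: (integrableB mD hf hg). Qed.

Lemma Rintegrable_measurable f : Rintegrable f -> measurable_fun D f.
Proof. by move=> /measurable_int/measurable_EFinP. Qed.

Lemma eq_Rintegrable f g : (forall x, D x -> f x = g x) ->
  Rintegrable f -> Rintegrable g.
Proof.
by move=> fg; apply: eq_integrable => // x /set_mem Dx /=; rewrite fg.
Qed.

Lemma Rintegrable_powR q g : 0 < q ->
  measurable_fun D (fun x => `|g x| `^ q) ->
  forall w : T -> R, measurable_fun D w -> (forall x, D x -> 0 <= w x) ->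
  (((\int[nu]_(x in D) (`|g x| `^ q * w x)%:E) `^ q^-1) < +oo)%E ->
  Rintegrable (fun x => `|g x| `^ q * w x).
Proof.
move=> q0 mg w mw w0 /lty_poweRy; rewrite gt_eqF ?invr_gt0// => /(_ isT) h.
apply/integrableP; split; first by apply/measurable_EFinP; exact: measurable_funM.
apply: le_lt_trans h; apply: ge0_le_integral => //=.
- apply/measurable_EFinP; apply: measurableT_comp => //.
  exact: measurable_funM.
- by apply/measurable_EFinP; exact: measurable_funM.
- by move=> x Dx; rewrite lee_fin ger0_norm// mulr_ge0 ?powR_ge0 ?w0.
Qed.
End integrability.

(** [Num.sqrt] is the power $1/2$ of the positive part; the truncation reproduces its value 0 on
    negative numbers. *)
Lemma measurable_sqrt (R : realType) : measurable_fun [set: R] (@Num.sqrt R).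
Proof.
have -> : @Num.sqrt R = fun x => Num.max 0 x `^ 2^-1.
  apply/funext => x; rewrite maxEle; case: ifPn => x0; first by rewrite powR12_sqrt.
  by rewrite powR12_sqrt// ler0_sqrtr ?sqrtr0// ltW// ltNge.
apply: (measurableT_comp (measurable_powR 2^-1)).
by apply: measurable_maxr => //; exact: measurable_cst.
Qed.

(** * Tensor fields in $L^2\cap L^3(w)$ *)

Section weighted.
Context d (T : measurableType d) (R : realType).
Variables (nu : {measure set T -> \bar R}) (D : set T) (w : T -> R).
Hypotheses (mD : measurable D) (mw : measurable_fun D w).
Hypothesis w0 : forall x, D x -> 0 < w x.
Implicit Types (f g : T -> R) (a b c : T -> mat R).

Local Notation intg := (Rintegrable nu D).

(** Membership in $L^2\cap L^3(w)$, phrased through integer powers so that pointwise polynomial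
    inequalities can be integrated directly. *)
Definition L23 g := [/\ measurable_fun D g, intg (fun x => g x ^+ 2) &
  intg (fun x => w x * `|g x| ^+ 3)].

Let mwcube g : measurable_fun D g -> measurable_fun D (fun x => w x * `|g x| ^+ 3).
Proof.
move=> mg; apply: measurable_funM => //; apply: measurable_funX.
exact: measurableT_comp.
Qed.

Lemma L23_le f g : measurable_fun D f -> L23 g ->
  (forall x, D x -> `|f x| <= `|g x|) -> L23 f.
Proof.
move=> mf [mg g2 g3] fg; split => //.
- apply: (Rintegrable_le mD _ g2); first exact: measurable_funX.
  by move=> x Dx; rewrite normrX -(real_normK (num_real (g x))) lerXn2r ?nnegrE// fg.
- apply: (Rintegrable_le mD _ g3); first exact: mwcube.
  move=> x Dx; rewrite normrM normrX normr_id (gtr0_norm (w0 Dx)).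
  by rewrite ler_pM2l ?w0// lerXn2r ?nnegrE// fg.
Qed.

Lemma L23Z k g : L23 g -> L23 (fun x => k * g x).
Proof.
move=> [mg g2 g3]; split.
- by apply: measurable_funM => //; exact: measurable_cst.
- apply: (eq_Rintegrable mD _ (RintegrableZ mD (k ^+ 2) g2)) => x _.
  by rewrite exprMn.
- apply: (eq_Rintegrable mD _ (RintegrableZ mD (`|k| ^+ 3) g3)) => x _.
  by rewrite normrM exprMn mulrCA.
Qed.

Lemma L23D f g : L23 f -> L23 g -> L23 (fun x => f x + g x).
Proof.
move=> [mf f2 f3] [mg g2 g3]; have mfg := measurable_funD mf mg; split => //.
- apply: (Rintegrable_le mD _ (RintegrableZ mD 2 (RintegrableD mD f2 g2))).
    exact: measurable_funX.
  move=> x _; rewrite ger0_norm ?sqr_ge0//.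
  have : 0 <= (f x - g x) ^+ 2 by rewrite sqr_ge0.
  by lra.
- apply: (Rintegrable_le mD _ (RintegrableZ mD 4 (RintegrableD mD f3 g3))).
    exact: mwcube.
  move=> x Dx; rewrite ger0_norm ?mulr_ge0 ?exprn_ge0 ?(ltW (w0 Dx))//.
  rewrite -mulrDr (mulrCA 4) ler_pM2l ?w0//.
  apply: (@le_trans _ _ ((`|f x| + `|g x|) ^+ 3)).
    by rewrite lerXn2r ?nnegrE ?addr_ge0// ler_normD.
  have := normr_ge0 (f x); have := normr_ge0 (g x).
  move: `|f x| `|g x| => y z z0 y0.
  (* Three times this quantity is $4(y^3+z^3)-(y+z)^3$. *)
  have : 0 <= (y + z) * (y - z) ^+ 2 by rewrite mulr_ge0 ?addr_ge0 ?sqr_ge0.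
  by lra.
Qed.

Lemma L23_0 : L23 (fun=> 0).
Proof.
have i0 : intg (fun=> 0) by exact: integrable0.
split; [exact: measurable_cst | apply: eq_Rintegrable i0 => // x _..].
  by rewrite expr0n.
by rewrite normr0 expr0n mulr0.
Qed.

Lemma L23_sum n (f : 'I_n -> T -> R) :
  (forall i, L23 (f i)) -> L23 (fun x => \sum_i f i x).
Proof.
move=> Lf; elim: n f Lf => [f _|n IH f Lf].
  by under [X in L23 X]eq_fun do rewrite big_ord0; exact: L23_0.
under [X in L23 X]eq_fun do rewrite big_ord_recl.
by apply: L23D => //; apply: IH.
Qed.

Lemma L23_norm g : L23 g -> L23 (fun x => `|g x|).
Proof.
move=> Lg; have [mg _ _] := Lg.
apply: (L23_le _ Lg); first exact: measurableT_comp.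
by move=> x _; rewrite normr_id.
Qed.

Lemma Rintegrable_mul f g : intg (fun x => f x ^+ 2) -> intg (fun x => g x ^+ 2) ->
  measurable_fun D f -> measurable_fun D g -> intg (fun x => f x * g x).
Proof.
move=> f2 g2 mf mg; apply: (Rintegrable_le mD _ (RintegrableD mD f2 g2)).
  exact: measurable_funM.
move=> x _; rewrite ler_norml.
have : 0 <= (f x - g x) ^+ 2 by rewrite sqr_ge0.
have : 0 <= (f x + g x) ^+ 2 by rewrite sqr_ge0.
by nra.
Qed.

Definition mL23 a := forall i j, L23 (fun x => a x i j).

Lemma mL23B a b : mL23 a -> mL23 b -> mL23 (fun x => a x - b x).
Proof.
move=> La Lb i j; under [X in L23 X]eq_fun do rewrite !mxE -mulN1r.
by apply: L23D => //; exact: L23Z.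
Qed.

Lemma mL23_sym a : mL23 a -> mL23 (fun x => sym (a x)).
Proof.
move=> La i j; under [X in L23 X]eq_fun do rewrite !mxE.
by apply: L23Z; exact: L23D.
Qed.

Lemma L23_tr a : mL23 a -> L23 (fun x => \tr (a x)).
Proof. by move=> La; apply: L23_sum => i; exact: La. Qed.

Let mcoef a : mL23 a -> forall i j, measurable_fun D (fun x => a x i j).
Proof. by move=> La i j; case: (La i j). Qed.

Lemma measurable_mdot a b : (forall i j, measurable_fun D (fun x => a x i j)) ->
  (forall i j, measurable_fun D (fun x => b x i j)) ->
  measurable_fun D (fun x => mdot (a x) (b x)).
Proof.
move=> ma mb; apply: measurable_sum => i; apply: measurable_sum => j.
exact: measurable_funM.
Qed.

Lemma measurable_mnorm a : (forall i j, measurable_fun D (fun x => a x i j)) ->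
  measurable_fun D (fun x => mnorm (a x)).
Proof.
move=> ma; apply: (measurableT_comp (@measurable_sqrt R)).
exact: measurable_mdot.
Qed.

Lemma L23_mnorm a : mL23 a -> L23 (fun x => mnorm (a x)).
Proof.
move=> La; apply: (@L23_le _ (fun x => \sum_i \sum_j `|a x i j|)).
- exact/measurable_mnorm/mcoef.
- by do 2!apply: L23_sum => ?; exact: L23_norm.
- move=> x _; rewrite ger0_norm ?mnorm_ge0//.
  exact: le_trans (mnorm_le_sum _) (ler_norm _).
Qed.

Lemma mnorm_sqr_int a : mL23 a -> intg (fun x => mnorm (a x) ^+ 2).
Proof. by move=> /L23_mnorm[]. Qed.

Lemma mnorm_cube_int a : mL23 a -> intg (fun x => w x * mnorm (a x) ^+ 3).
Proof.
move=> /L23_mnorm[_ _]; apply: eq_Rintegrable => // x _.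
by rewrite ger0_norm ?mnorm_ge0.
Qed.

Lemma mdot_int a b : mL23 a -> mL23 b -> intg (fun x => mdot (a x) (b x)).
Proof.
move=> La Lb; have [ma a2 _] := L23_mnorm La; have [mb b2 _] := L23_mnorm Lb.
apply: (Rintegrable_le mD _ (Rintegrable_mul a2 b2 ma mb)).
  by apply: measurable_mdot; exact: mcoef.
by move=> x _; exact: mdot_le_mnorm.
Qed.

Lemma smag_int mu k a b : 0 < mu -> 0 < k -> mL23 a -> mL23 b ->
  intg (fun x => mdot (smag mu k (w x) (a x)) (b x)).
Proof.
move=> mu0 k0 La Lb; have [ma a2 a3] := L23_mnorm La.
have [mb b2 b3] := L23_mnorm Lb.
have i2 := RintegrableZ mD (2 * mu) (mdot_int La Lb).
have i3 : intg (fun x => w x * mnorm (a x) * mdot (a x) (b x)).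
  apply: (Rintegrable_le mD _ (RintegrableD mD a3 b3)).
    apply: measurable_funM; first exact: measurable_funM.
    by apply: measurable_mdot; exact: mcoef.
  move=> x Dx; rewrite !(ger0_norm (mnorm_ge0 _)) -mulrDr.
  rewrite -mulrA normrM (gtr0_norm (w0 Dx)) ler_pM2l ?w0//.
  rewrite normrM (ger0_norm (mnorm_ge0 _)).
  have h := mdot_le_mnorm (a x) (b x).
  apply: le_trans (ler_wpM2l (mnorm_ge0 _) h) _.
  have x0 := mnorm_ge0 (a x); have y0 := mnorm_ge0 (b x).
  rewrite mulrA; apply: le_trans (amgm3 x0 x0 y0) _.
  by move: (exprn_ge0 3 x0) (exprn_ge0 3 y0); lra.
apply: (eq_Rintegrable mD _ (RintegrableD mD i2 (RintegrableZ mD (2 * k) i3))).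
by move=> x Dx; rewrite /smag mdotZl; ring.
Qed.

End weighted.

(** The choice $s^3=\sqrt Y$ balances $Ks^3$ against $Y/s^3$. This is the origin of $\sqrt Y$, that
    is, of the exponent $3/2$ on the $L^3$ norm. *)
Lemma error_absorption (R : realType) (mu k K : R) : 0 < mu -> 0 < k -> 0 <= K ->
  exists2 C : R, 0 < C & forall x y X Y : R,
    0 <= x -> 0 <= y -> 0 <= X -> 0 <= Y ->
    (forall s, 0 < s -> mu * x - 2 * mu * X +
       2 * k * (5 / 12 * y - s ^+ 3 * K / 3 - 16 / 3 * Y / s ^+ 3) <= 0) ->
    x + y <= C * (X + Num.sqrt Y).
Proof.
move=> mu0 k0 K0; pose m := Num.min mu (5 / 6 * k).
have m0 : 0 < m by rewrite lt_min mu0 mulr_gt0.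
(* [m] is the smaller coefficient of [x] and [y] on the left, and 11 rounds up $2\cdot 16/3$. *)
exists ((2 * mu + 2 * k * K + 11 * k) / m).
  by rewrite divr_gt0//; have := mulr_ge0 (ltW k0) K0; lra.
move=> x y X Y x0 y0 X0 Y0 H.
have r0 := sqrtr_ge0 Y; rewrite mulrAC ler_pdivlMr//.
have lhs : (x + y) * m <= mu * x + 5 / 6 * k * y.
  rewrite mulrDl (mulrC x) (mulrC y) lerD// ler_wpM2r//.
    by rewrite ge_min lexx.
  by rewrite ge_min lexx orbT.
apply: (le_trans lhs); apply/ler_addgt0Pr => e e0.
have kK : 0 <= k * K by rewrite mulr_ge0// ltW.
(* [t] plays the role of $s^3$. The shift keeps it positive when $Y=0$ and raises $kKt$ by at most
   [e]. *)
pose t := Num.sqrt Y + e / (k * K + 1).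
have d0 : 0 < e / (k * K + 1) by rewrite divr_gt0// ltr_wpDl.
have t0 : 0 < t by rewrite ltr_wpDl.
have Yt : Y / t <= Num.sqrt Y.
  rewrite ler_pdivrMr// -{1}(sqr_sqrtr Y0) expr2 ler_wpM2l//.
  by rewrite lerDl ltW.
have /H : 0 < t `^ 3^-1 by rewrite powR_gt0.
have -> : (t `^ 3^-1) ^+ 3 = t.
  by rewrite -powR_mulrn ?powR_ge0// -powRrM mulVf ?powRr1// ltW.
have te : k * K * t <= k * K * Num.sqrt Y + e.
  rewrite mulrDr lerD2l mulrA ler_pdivrMr ?ltr_wpDl//.
  by rewrite mulrC ler_wpM2l ?(ltW e0)// lerDl.
rewrite -(mulrA (16 / 3)); move: Yt te r0.
move: (Y / t) (Num.sqrt Y) => p r pr te r0 h.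
have h1 : 0 <= k * (r - p) by rewrite mulr_ge0 ?subr_ge0// ltW.
have h2 : 0 <= k * r by rewrite mulr_ge0// ltW.
have h3 : 0 <= k * X by rewrite mulr_ge0// ltW.
have h4 : 0 <= mu * r by rewrite mulr_ge0// ltW.
have h5 : 0 <= k * K * X by rewrite mulr_ge0.
have h6 : 0 <= k * K * r by rewrite mulr_ge0.
by lra.
Qed.

(** * Integrated a priori and error bounds *)

Section weighted_estimates.
Context d (T : measurableType d) (R : realType).
Variables (nu : {measure set T -> \bar R}) (D : set T) (w : T -> R).
Hypotheses (mD : measurable D) (mw : measurable_fun D w).
Hypothesis w0 : forall x, D x -> 0 < w x.
Variables (mu k : R).
Hypotheses (mu0 : 0 < mu) (k0 : 0 < k).
Implicit Types (f g q : T -> R) (a b c : T -> mat R).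

Local Notation intg := (Rintegrable nu D).
Local Notation mL23 := (mL23 nu D w).
Local Notation dual q := (fun x => `|q x| `^ conj_exp 3 * w x `^ (1 - 3)^-1).

(** Each summand of the pressure meets one of the two norms of [b]: [q1] pairs in $L^2$, [q2]
    against $L^3(w)$ through [young_dual]. *)
Lemma pressure_int q1 q2 b : measurable_fun D q1 -> measurable_fun D q2 ->
  intg (fun x => q1 x ^+ 2) -> intg (dual q2) -> mL23 b ->
  intg (fun x => (q1 x + q2 x) * \tr (b x)).
Proof.
move=> mq1 mq2 q1i q2i Lb; have [mt t2 _] := L23_tr mD mw w0 Lb.
have [_ _ b3] := L23_mnorm mD mw w0 Lb.
have i1 := Rintegrable_mul mD q1i t2 mq1 mt.
have [C C0 CP] := young_dual (@ltr01 R).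
have i2 : intg (fun x => q2 x * \tr (b x)).
  pose G := RintegrableZ mD 2 (RintegrableD mD b3 (RintegrableZ mD C q2i)).
  apply: (Rintegrable_le mD _ G); first exact: measurable_funM.
  move=> x Dx; rewrite normrM (ger0_norm (mnorm_ge0 _)).
  have := CP _ _ _ (w0 Dx) (normr_ge0 (q2 x)) (mnorm_ge0 (b x)).
  rewrite mul1r => h.
  apply: le_trans (ler_wpM2l (normr_ge0 _) (trace_le_mnorm _)) _.
  by rewrite mulrCA ler_wpM2l.
by apply: (eq_Rintegrable mD _ (RintegrableD mD i1 i2)) => x _; rewrite mulrDl.
Qed.

(** Integrates [smag_coercive]. Since [K] is chosen before [b], one fixed reference field [a] with
    its pressure bounds all fields satisfying the energy identity. *)
Lemma smag_energy_bound a q1 q2 : mL23 a ->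
  measurable_fun D q1 -> measurable_fun D q2 ->
  intg (fun x => q1 x ^+ 2) -> intg (dual q2) ->
  exists2 K : R, 0 <= K & forall b, mL23 b ->
    \int[nu]_(x in D) mdot (smag mu k (w x) (b x)) (b x) =
    \int[nu]_(x in D) mdot (smag mu k (w x) (a x)) (b x) -
      \int[nu]_(x in D) ((q1 x + q2 x) * \tr (b x)) ->
    \int[nu]_(x in D) (w x * mnorm (b x) ^+ 3) <= K.
Proof.
move=> La mq1 mq2 q1i q2i; have [C C0 CP] := smag_coercive mu0 k0.
pose G x := C * (mnorm (a x) ^+ 2 + w x * mnorm (a x) ^+ 3 + q1 x ^+ 2 +
  `|q2 x| `^ conj_exp 3 * w x `^ (1 - 3)^-1).
have iG : intg G.
  have i1 := mnorm_sqr_int mD mw w0 La; have i2 := mnorm_cube_int mD mw w0 La.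
  have i12 := RintegrableD mD i1 i2.
  exact: (RintegrableZ mD C (RintegrableD mD (RintegrableD mD i12 q1i) q2i)).
have G0 x : D x -> 0 <= G x.
  move=> Dx; rewrite mulr_ge0 ?(ltW C0)// !addr_ge0 ?sqr_ge0//.
    by rewrite mulr_ge0 ?exprn_ge0 ?mnorm_ge0// ltW// w0.
  by rewrite mulr_ge0 ?powR_ge0.
exists (k^-1 * \int[nu]_(x in D) G x).
  by rewrite mulr_ge0 ?invr_ge0 ?(ltW k0)//; exact: Rintegral_ge0.
move=> b Lb E; rewrite -(ler_pM2l k0) mulVKf ?gt_eqF//.
have ib := mnorm_cube_int mD mw w0 Lb.
have ibb := smag_int mD mw w0 mu0 k0 Lb Lb.
have iab := smag_int mD mw w0 mu0 k0 La Lb.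
have ip := pressure_int mq1 mq2 q1i q2i Lb.
rewrite -RintegralZl//.
have ibp := RintegrableD mD (RintegrableB mD ibb iab) ip.
have iB := RintegrableB mD ibb iab; have ibG := RintegrableD mD ibp iG.
(* By [E] the added terms integrate to 0, and the new integrand is the right side of
   [smag_coercive]. *)
have -> : \int[nu]_(x in D) G x = \int[nu]_(x in D)
  (mdot (smag mu k (w x) (b x)) (b x) - mdot (smag mu k (w x) (a x)) (b x)
   + (q1 x + q2 x) * \tr (b x) + G x).
  rewrite RintegralD// RintegralD//.
  by rewrite RintegralB// E; ring.
apply: le_Rintegral => //; first exact: RintegrableZ.
by move=> x Dx; apply: CP; exact: w0.
Qed.

(** The assumed identity is the error equation. It makes the right side of [smag_error] integrate to
    0 for every [s], after which [error_absorption] applies with $2K$, as both [a] and [b]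
    contribute a cubic energy. *)
Lemma smag_error_bound K : 0 <= K -> exists2 C : R, 0 < C & forall a b c,
  mL23 a -> mL23 b -> mL23 c ->
  \int[nu]_(x in D) (w x * mnorm (a x) ^+ 3) <= K ->
  \int[nu]_(x in D) (w x * mnorm (b x) ^+ 3) <= K ->
  \int[nu]_(x in D) mdot (smag mu k (w x) (a x)) (c x - b x) -
  \int[nu]_(x in D) mdot (smag mu k (w x) (b x)) (c x - b x) =
  2 * mu * \int[nu]_(x in D) mdot (a x - c x) (c x - b x) ->
  \int[nu]_(x in D) (mnorm (a x - b x) ^+ 2) +
  \int[nu]_(x in D) (w x * mnorm (a x - b x) ^+ 3) <=
  C * (\int[nu]_(x in D) (mnorm (a x - c x) ^+ 2) +
    Num.sqrt (\int[nu]_(x in D) (w x * mnorm (a x - c x) ^+ 3))).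
Proof.
move=> K0; have [|C C0 CP] := @error_absorption _ mu k (K + K) mu0 k0.
  exact: addr_ge0.
exists C => // a b c La Lb Lc aK bK E.
have Lab := mL23B mD mw w0 La Lb; have Lac := mL23B mD mw w0 La Lc.
have Lcb := mL23B mD mw w0 Lc Lb.
have cube0 (f : T -> mat R) : 0 <= \int[nu]_(x in D) (w x * mnorm (f x) ^+ 3) :> R.
  apply: Rintegral_ge0 => x Dx.
  by rewrite mulr_ge0 ?exprn_ge0 ?mnorm_ge0// ltW// w0.
have sqr0 (f : T -> mat R) : 0 <= \int[nu]_(x in D) (mnorm (f x) ^+ 2) :> R.
  by apply: Rintegral_ge0 => x Dx; rewrite sqr_ge0.
apply: CP => // s s0.
have iab2 := mnorm_sqr_int mD mw w0 Lab.
have iac2 := mnorm_sqr_int mD mw w0 Lac.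
have iab3 := mnorm_cube_int mD mw w0 Lab.
have iac3 := mnorm_cube_int mD mw w0 Lac.
have ia3 := mnorm_cube_int mD mw w0 La.
have ib3 := mnorm_cube_int mD mw w0 Lb.
have ia := smag_int mD mw w0 mu0 k0 La Lcb.
have ib := smag_int mD mw w0 mu0 k0 Lb Lcb.
have ic := mdot_int mD mw w0 Lac Lcb.
have iab := RintegrableB mD ia ib; have icZ := RintegrableZ mD (2 * mu) ic.
have J x : mdot (smag mu k (w x) (a x) - smag mu k (w x) (b x) -
      (2 * mu) *: (a x - c x)) (c x - b x) =
    mdot (smag mu k (w x) (a x)) (c x - b x) -
    mdot (smag mu k (w x) (b x)) (c x - b x) -
    2 * mu * mdot (a x - c x) (c x - b x) by rewrite -(mdotZl (2 * mu)) -2!mdotBl.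
have J0 : \int[nu]_(x in D) mdot (smag mu k (w x) (a x) -
    smag mu k (w x) (b x) - (2 * mu) *: (a x - c x)) (c x - b x) = 0.
  under eq_Rintegral do rewrite J.
  by rewrite RintegralB// RintegralB// RintegralZl// E subrr.
have iJ : intg (fun x => mdot (smag mu k (w x) (a x) -
    smag mu k (w x) (b x) - (2 * mu) *: (a x - c x)) (c x - b x)).
  apply: (eq_Rintegrable mD _ (RintegrableB mD iab icZ)) => x _.
  by rewrite J.
(* The left side of [smag_error], regrouped as a linear combination of integrable functions. *)
pose L x := mu * mnorm (a x - b x) ^+ 2 - 2 * mu * mnorm (a x - c x) ^+ 2 +
  2 * k * (5 / 12 * (w x * mnorm (a x - b x) ^+ 3)
    - s ^+ 3 / 3 * (w x * mnorm (a x) ^+ 3 + w x * mnorm (b x) ^+ 3)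
    - 16 / 3 / s ^+ 3 * (w x * mnorm (a x - c x) ^+ 3)).
have i1 := RintegrableZ mD mu iab2.
have i2 := RintegrableZ mD (2 * mu) iac2.
have i3 := RintegrableZ mD (5 / 12) iab3.
have i4 := RintegrableZ mD (s ^+ 3 / 3) (RintegrableD mD ia3 ib3).
have i5 := RintegrableZ mD (16 / 3 / s ^+ 3) iac3.
have i34 := RintegrableB mD i3 i4.
have i345 := RintegrableB mD i34 i5; have iZ := RintegrableZ mD (2 * k) i345.
have iab3D := RintegrableD mD ia3 ib3.
have i12 := RintegrableB mD i1 i2.
have iL : intg L := RintegrableD mD i12 iZ.
have : \int[nu]_(x in D) L x <= 0.
  rewrite -[leRHS]J0; apply: le_Rintegral => // x Dx.
  apply: le_trans (smag_error mu0 k0 _ _ _ (ltW (w0 Dx)) s0).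
  by rewrite le_eqVlt /L; apply/orP; left; apply/eqP; field; rewrite gt_eqF.
rewrite /L RintegralD// RintegralZl// RintegralB// RintegralB// RintegralB//.
rewrite !RintegralZl// RintegralD//; apply: le_trans.
have := lerD aK bK; have s30 : 0 < s ^+ 3 by rewrite exprn_gt0.
move: (s ^+ 3) s30 => r r0.
move: (Rintegral nu D _) (Rintegral nu D _) (Rintegral nu D _)
  (Rintegral nu D _) (Rintegral nu D _) => X1 X2 X3 X4 X5 h.
have {}h : 0 <= k * (r * (K + K - (X5 + X4))).
  by rewrite !mulr_ge0 ?subr_ge0// ltW.
by lra.
Qed.

End weighted_estimates.

(** * Measure of slabs *)

Section product_sections.
Local Open Scope ereal_scope.
Context d1 d2 (T1 : measurableType d1) (T2 : measurableType d2) (R : realType).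
Variable m2 : {sigma_finite_measure set T2 -> \bar R}.

(** The product measure integrates the measures of the sections, which are empty over the complement
    of [B]. With [m1] an arbitrary measure, the first factor may itself be the planar product. *)
Lemma product_measure_le_xsection (m1 : {measure set T1 -> \bar R})
    (S : set (T1 * T2)) (B : set T1) (K : R) :
  measurable S -> measurable B -> (0 <= K)%R -> (forall z, S z -> B z.1) ->
  (forall x, m2 (xsection S x) <= K%:E) -> (m1 \x m2) S <= K%:E * m1 B.
Proof.
move=> mS mB K0 SB Sle.
rewrite -[in leRHS](setIT B) -integral_indic// -ge0_integralZl//; last first.
  by apply/measurable_EFinP; exact: measurable_indic.
apply: ge0_le_integral => //.
- exact: measurable_fun_xsection.
- apply: measurable_funeM; apply/measurable_EFinP; exact: measurable_indic.
move=> x _ /=; rewrite indicE; case: (boolP (x \in B)) => xB.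
  by rewrite mule1; exact: Sle.
rewrite mule0 (_ : xsection S x = set0) ?measure0//.
rewrite -subset0 => y; rewrite /xsection/= inE => /SB/= xB'.
by move: xB; rewrite notin_setE.
Qed.

(** The same bound in the other order of integration, which uniqueness of the product of
    sigma-finite measures identifies with the first. *)
Lemma product_measure_le_ysection
    (m1 : {sigma_finite_measure set T1 -> \bar R})
    (S : set (T1 * T2)) (B : set T2) (K : R) :
  measurable S -> measurable B -> (0 <= K)%R -> (forall z, S z -> B z.2) ->
  (forall y, m1 (ysection S y) <= K%:E) -> (m1 \x m2) S <= K%:E * m2 B.
Proof.
move=> mS mB K0 SB Sle.
rewrite (@product_measure_unique _ _ _ _ _ m1 m2 (m1 \x^ m2))//; last first.
  by move=> A B' mA mB'; exact: product_measure2E.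
rewrite -[in leRHS](setIT B) -integral_indic// -ge0_integralZl//; last first.
  by apply/measurable_EFinP; exact: measurable_indic.
apply: ge0_le_integral => //.
- exact: measurable_fun_ysection.
- apply: measurable_funeM; apply/measurable_EFinP; exact: measurable_indic.
move=> y _ /=; rewrite indicE; case: (boolP (y \in B)) => yB.
  by rewrite mule1; exact: Sle.
rewrite mule0 (_ : ysection S y = set0) ?measure0//.
rewrite -subset0 => x; rewrite /ysection/= inE => /SB/= yB'.
by move: yB; rewrite notin_setE.
Qed.
End product_sections.

Section slabs.
Variable R : realType.
Local Notation leb := (@lebesgue_measure R).

(** [S] lies in the interval of radius [r] around any of its points, hence the factor 2. *)
Lemma lebesgue_le_diam (S : set (measurableTypeR R)) (r : R) : measurable S ->
  0 <= r -> (forall s t, S s -> S t -> `|s - t| <= r) -> (leb S <= (2 * r)%:E)%E.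
Proof.
move=> mS r0 dS; have [->|/set0P[t St]] := eqVneq S set0.
  by rewrite measure0 lee_fin mulr_ge0.
have -> : (2 * r)%:E = leb `[t - r, t + r]%classic.
  rewrite lebesgue_measure_itv/= lte_fin; case: ifPn => [_|].
    by rewrite -EFinB; congr EFin; ring.
  by rewrite -leNgt => h; congr EFin; lra.
apply: le_measure; rewrite ?inE//.
by move=> s /dS/(_ St); rewrite /= in_itv/= ler_distl.
Qed.

Definition cube (N : R) : set (pt R) :=
  [set x | [/\ `|x.1.1| <= N, `|x.1.2| <= N & `|x.2| <= N]].

Lemma pdotE (a x : pt R) :
  pdot a x = a.1.1 * x.1.1 + a.1.2 * x.1.2 + a.2 * x.2.
Proof. by rewrite /pdot !big_ord_recl big_ord0 /xyz/= addr0 !addrA. Qed.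

Let line (N : R) : set (measurableTypeR R) := `[- N, N]%classic.

Let mline N : measurable (line N). Proof. exact: measurable_itv. Qed.

Let lineP N s : `|s| <= N -> line N s.
Proof. by rewrite /line/= in_itv/= ler_norml. Qed.

Let leb_line N : 0 <= N -> (leb (line N) <= (2 * (2 * N))%:E)%E.
Proof.
move=> N0; apply: lebesgue_le_diam; first exact: mline.
  by rewrite mulr_ge0.
move=> s t; rewrite /line/= !in_itv/= => /andP[s1 s2] /andP[t1 t2].
by rewrite ler_norml; apply/andP; split; lra.
Qed.

Let leb_diam (c r : R) (V : set (measurableTypeR R)) : c != 0 -> 0 <= r ->
  measurable V -> (forall s t, V s -> V t -> `|c * s - c * t| <= r) ->
  (leb V <= (2 * (r / `|c|))%:E)%E.
Proof.
move=> c0 r0 mV dV; apply: lebesgue_le_diam => //; first by rewrite divr_ge0.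
move=> s t Vs Vt; rewrite ler_pdivlMr ?normr_gt0// -normrM mulrC mulrBr.
exact: dV.
Qed.

(** Sections along a coordinate with nonzero coefficient $a_i$ have diameter at most $r/|a_i|$; the
    other coordinate ranges over a segment of length at most [b]. *)
Let mu2_slab (a1 a2 N : R) : (a1 != 0) || (a2 != 0) -> 0 <= N ->
  exists2 K : R, 0 <= K & forall (r : R)
      (S : set (measurableTypeR R * measurableTypeR R)), 0 <= r ->
    measurable S -> S `<=` line N `*` line N ->
    (forall x y, S x -> S y ->
      `|a1 * x.1 + a2 * x.2 - (a1 * y.1 + a2 * y.2)| <= r) ->
    ((leb \x leb) S <= (K * r)%:E)%E.
Proof.
move=> a12 N0; pose b : R := 2 * (2 * N).
have b0 : 0 <= b by rewrite !mulr_ge0.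
have lb : (leb (line N) <= b%:E)%E := leb_line N0.
have [a20|a20] := eqVneq a2 0; last first.
  exists (2 / `|a2| * b); first by rewrite !mulr_ge0 ?invr_ge0.
  move=> r S r0 mS SN dS.
  have K0 : 0 <= 2 * (r / `|a2|) by rewrite mulr_ge0 ?divr_ge0.
  apply: le_trans (@product_measure_le_xsection _ _ _ _ R leb leb S _ _ mS
    (mline N) K0 _ _) _.
  - by move=> x /SN[].
  - move=> x; apply: leb_diam => //; first exact: measurable_xsection.
    move=> s t; rewrite /xsection/= !inE => /dS h /h{h}/=.
    by congr (_ <= _); congr (`|_|); ring.
  - apply: le_trans (lee_wpmul2l _ lb) _; first by rewrite lee_fin.
    by rewrite -EFinM lee_fin le_eqVlt; apply/orP; left; apply/eqP; ring.
rewrite a20 eqxx orbF in a12.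
exists (2 / `|a1| * b); first by rewrite !mulr_ge0 ?invr_ge0.
move=> r S r0 mS SN dS.
have K0 : 0 <= 2 * (r / `|a1|) by rewrite mulr_ge0 ?divr_ge0.
apply: le_trans (@product_measure_le_ysection _ _ _ _ R leb leb S _ _ mS
  (mline N) K0 _ _) _.
- by move=> x /SN[].
- move=> x; apply: leb_diam => //; first exact: measurable_ysection.
  move=> s t; rewrite /ysection/= !inE => /dS h /h{h}/=.
  by congr (_ <= _); congr (`|_|); ring.
- apply: le_trans (lee_wpmul2l _ lb) _; first by rewrite lee_fin.
  by rewrite -EFinM lee_fin le_eqVlt; apply/orP; left; apply/eqP; ring.
Qed.

(** If the third coefficient is nonzero, sections in the third variable are short. Otherwise the set
    lies in the product of a planar strip and a segment. *)
Lemma mu3_slab (a : pt R) (N : R) : a != 0 -> 0 <= N ->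
  exists2 K : R, 0 <= K & forall (r : R) (S : set (mpt R)), 0 <= r ->
    measurable S -> S `<=` cube N ->
    (forall x y, S x -> S y -> `|pdot a x - pdot a y| <= r) ->
    (mu3 R S <= (K * r)%:E)%E.
Proof.
move=> a0 N0; pose b : R := 2 * (2 * N).
have b0 : 0 <= b by rewrite !mulr_ge0.
have lb : (leb (line N) <= b%:E)%E := leb_line N0.
pose B2 : set (measurableTypeR R * measurableTypeR R) := line N `*` line N.
have mB2 : measurable B2 by exact: measurableX.
have lB2 : ((leb \x leb) B2 <= b%:E * b%:E)%E.
  by rewrite product_measure1E// lee_pmul.
have [a3|a3] := eqVneq a.2 0; last first.
  exists (2 / `|a.2| * (b * b)); first by rewrite !mulr_ge0 ?invr_ge0.
  move=> r S r0 mS SN dS.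
  have K0 : 0 <= 2 * (r / `|a.2|) by rewrite mulr_ge0 ?divr_ge0.
  apply: le_trans (@product_measure_le_xsection _ _ _ _ R leb (leb \x leb)%E S
    _ _ mS mB2 K0 _ _) _.
  - by move=> [[x1 x2] x3] /SN[/= h1 h2 _]; split; exact: lineP.
  - move=> x; apply: leb_diam => //; first exact: measurable_xsection.
    move=> s t; rewrite /xsection/= !inE => /dS h /h{h}.
    by rewrite !pdotE/=; congr (_ <= _); congr (`|_|); ring.
  - apply: le_trans (lee_wpmul2l _ lB2) _; first by rewrite lee_fin.
    by rewrite -!EFinM lee_fin le_eqVlt; apply/orP; left; apply/eqP; ring.
have a12 : (a.1.1 != 0) || (a.1.2 != 0).
  rewrite -negb_and; apply: contraNN a0 => /andP[/eqP a1 /eqP a2].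
  by case: a a1 a2 a3 => [[? ?] ?] /= -> -> ->.
have [K K0 KP] := mu2_slab a12 N0.
exists (K * 2 * b); first by rewrite !mulr_ge0.
move=> r S r0 mS SN dS; have [->|/set0P[z Sz]] := eqVneq S set0.
  by rewrite measure0 lee_fin !mulr_ge0.
pose g (x : measurableTypeR R * measurableTypeR R) : R :=
  a.1.1 * x.1 + a.1.2 * x.2.
have mg : measurable_fun setT g.
  by apply: measurable_funD; apply: measurable_funM => //; exact: measurable_cst.
(* The strip of half-width [r] around the projection of one point of [S]; its width $2r$ explains
   the 2 in the constant. *)
pose P := B2 `&` (fun x => `|g x - g z.1|) @^-1` `]-oo, r].
have mP : measurable P.
  apply: measurableI => //; rewrite -[X in measurable X]setTI.
  have mgz : measurable_fun setT (fun x => `|g x - g z.1|).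
    by apply: measurableT_comp => //; apply: measurable_funB.
  by apply: mgz => //; exact: measurable_itv.
have SP : S `<=` P `*` line N.
  move=> x Sx; have [h1 h2 h3] := SN _ Sx; split; last exact: lineP.
  split; first by split; exact: lineP.
  by have := dS _ _ Sx Sz; rewrite !pdotE a3 !mul0r !addr0 /= in_itv.
apply: (@le_trans _ _ (mu3 R (P `*` line N))).
  by apply: le_measure; rewrite ?inE//; exact: measurableX.
rewrite /mu3/= product_measure1E//.
have r2 : 0 <= 2 * r by rewrite mulr_ge0.
apply: (@le_trans _ _ ((K * (2 * r))%:E * b%:E)%E).
  apply: lee_pmul => //; apply: KP => //.
    by move=> x [].
  move=> x y [_ /=]; rewrite in_itv/= => hx [_ /=]; rewrite in_itv/= => hy.
  have -> : a.1.1 * x.1 + a.1.2 * x.2 - (a.1.1 * y.1 + a.1.2 * y.2) =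
    (g x - g z.1) - (g y - g z.1) by rewrite /g; ring.
  by rewrite (le_trans (ler_normB _ _))//; lra.
by rewrite -EFinM lee_fin le_eqVlt; apply/orP; left; apply/eqP; ring.
Qed.

(** The cube is a slab of width $2N$ in the first coordinate direction. *)
Lemma mu3_cube_lty (N : R) (S : set (mpt R)) : 0 <= N ->
  measurable S -> S `<=` cube N -> (mu3 R S < +oo)%E.
Proof.
move=> N0 mS SN; pose a : pt R := (1, 0, 0).
have [|K K0 KP] := @mu3_slab a N _ N0.
  by apply/eqP => -[/eqP]; rewrite oner_eq0.
have h : 0 <= 2 * N by rewrite mulr_ge0.
apply: le_lt_trans (KP _ S h mS SN _) (ltry _).
move=> x y /SN[x1 _ _] /SN[y1 _ _]; rewrite !pdotE /= !mul0r !mul1r !addr0.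
rewrite (le_trans (ler_normB _ _))//; lra.
Qed.
End slabs.

(** * Distance to the boundary of a polyhedron *)

Section euclidean.
Variable R : realType.
Implicit Types (x y z a : pt R) (Om : set (pt R)).

(** Turns [pdot] and [enorm] into [mdot] and [mnorm], so that Cauchy-Schwarz and the triangle
    inequality carry over to points. *)
Definition rowpt x : 'rV[R]_3 := \row_i xyz x i.

Lemma rowptB x y : rowpt (x - y) = rowpt x - rowpt y.
Proof.
apply/rowP => i; rewrite !mxE /xyz.
by case: i => -[|[|[|//]]] ? /=.
Qed.

Lemma pdot_rowpt x y : pdot x y = mdot (rowpt x) (rowpt y).
Proof. by rewrite /mdot big_ord1; apply: eq_bigr => i _; rewrite !mxE. Qed.

Lemma enorm_rowpt x : enorm x = mnorm (rowpt x).
Proof. by rewrite /enorm pdot_rowpt. Qed.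

Lemma pdotBr a x y : pdot a (x - y) = pdot a x - pdot a y.
Proof. by rewrite !pdot_rowpt rowptB mdotBr. Qed.

Lemma pdot_le_enorm a x : pdot a x <= enorm a * enorm x.
Proof.
by rewrite pdot_rowpt !enorm_rowpt (le_trans (ler_norm _))// mdot_le_mnorm.
Qed.

Lemma enorm_ge0 x : 0 <= enorm x.
Proof. by rewrite enorm_rowpt mnorm_ge0. Qed.

Lemma enormC x y : enorm (x - y) = enorm (y - x).
Proof.
rewrite !enorm_rowpt !rowptB -[rowpt x - _]opprB /mnorm -scaleN1r.
by rewrite mdotZl mdotC mdotZl !mulN1r opprK.
Qed.

Lemma enorm_triangle x y z : enorm (x - z) <= enorm (y - z) + enorm (x - y).
Proof.
rewrite (enormC x y) !enorm_rowpt !rowptB.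
have -> : rowpt x - rowpt z = (rowpt y - rowpt z) - (rowpt y - rowpt x).
  by apply/matrixP => i j; rewrite !mxE; ring.
exact: mnormB.
Qed.

Lemma enorm_le_sum x : enorm x <= `|x.1.1| + `|x.1.2| + `|x.2|.
Proof.
rewrite enorm_rowpt (le_trans (mnorm_le_sum _))// big_ord1.
by rewrite !big_ord_recl big_ord0 !mxE /xyz/= addr0 addrA.
Qed.

Lemma dist_bd_ge0 Om x : 0 <= dist_bd Om x.
Proof.
rewrite /dist_bd; set E := [set _ | _ in _].
(* The infimum of the empty set is 0 by convention. *)
have [->|/set0P E0] := eqVneq E set0; first by rewrite inf0.
by apply: lb_le_inf => // _ [y _ <-]; exact: enorm_ge0.
Qed.

Lemma dist_bd_le Om x y : boundary Om y -> dist_bd Om x <= enorm (x - y).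
Proof.
move=> by_; apply: ge_inf; last by exists y.
by exists 0 => _ [z _ <-]; exact: enorm_ge0.
Qed.

Lemma dist_bd_lipschitz Om x y :
  dist_bd Om x <= dist_bd Om y + enorm (x - y).
Proof.
have [bd0|/set0P[z bz]] := eqVneq (boundary Om) set0.
  by rewrite /dist_bd bd0 !image_set0 !inf0 add0r enorm_ge0.
rewrite -lerBlDr; apply: lb_le_inf; first by exists (enorm (y - z)); exists z.
move=> _ [t bt <-]; rewrite lerBlDr.
exact: le_trans (dist_bd_le _ bt) (enorm_triangle _ _ _).
Qed.

(* [g] is below [r] exactly on a union of rational cubes [|x - q| < e] with
   [g q + 3 e < r]. *)
Lemma measurable_lipschitz (g : pt R -> R) :
  (forall x y, g x <= g y + (`|x.1.1 - y.1.1| + `|x.1.2 - y.1.2| +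
    `|x.2 - y.2|)) ->
  measurable_fun [set: mpt R] (g : mpt R -> R).
Proof.
move=> gL; apply: (measurability _ (RGenInftyO.measurableE R)).
move=> _ [_ [r ->] <-]; rewrite setTI.
pose Q (q1 q2 q3 e : rat) : set (mpt R) :=
  (ball (ratr q1 : R) (ratr e) `*` ball (ratr q2 : R) (ratr e)) `*`
   ball (ratr q3 : R) (ratr e).
pose F q1 q2 q3 e : set (mpt R) :=
  if g (ratr q1, ratr q2, ratr q3) + 3 * ratr e < r then Q q1 q2 q3 e else set0.
have -> : g @^-1` `]-oo, r[ =
    \bigcup_q1 \bigcup_q2 \bigcup_q3 \bigcup_e F q1 q2 q3 e.
  apply/seteqP; split => x /=; last first.
    move=> [q1 _ [q2 _ [q3 _ [e _]]]]; rewrite /F; case: ifPn => // h.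
    move=> [[]]; rewrite /ball/= => h1 h2 h3; rewrite in_itv/=.
    have := gL x (ratr q1, ratr q2, ratr q3); rewrite /= => h4.
    move: h1 h2 h3; rewrite !(distrC (ratr _)) => h1 h2 h3.
    by lra.
  rewrite in_itv/= => gr.
  (* Six times [e]: passing from [x] to the rational centre costs [e] in each of three coordinates,
     and [F] asks for a further margin of $3e$. *)
  have d0 : 0 < (r - g x) / 6 by rewrite divr_gt0// subr_gt0.
  have [e] := rat_in_itvoo d0.
  rewrite in_itv/= => /andP[e0 er].
  have approx (s : R) : exists q : rat, `|s - ratr q| < ratr e.
    have se : s - ratr e < s + ratr e by rewrite ltrD2l gt0_cp.
    have [q] := rat_in_itvoo se.
    by rewrite in_itv/= => /andP[? ?]; exists q; rewrite ltr_distlC; apply/andP.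
  have [q1 h1] := approx x.1.1; have [q2 h2] := approx x.1.2.
  have [q3 h3] := approx x.2.
  exists q1 => //; exists q2 => //; exists q3 => //; exists e => //.
  rewrite /F ifT; last first.
    have := gL (ratr q1, ratr q2, ratr q3) x; rewrite /= => h4.
    move: h1 h2 h3; rewrite !(distrC _ (ratr _)) => h1 h2 h3.
    by lra.
  by split; [split|]; rewrite /ball/= distrC.
do 4 (apply: bigcupT_measurable_rat => ?).
rewrite /F; case: ifPn => // _.
by apply: measurableX; [apply: measurableX|]; exact: measurable_ball.
Qed.

Lemma measurable_dist_bd Om : measurable_fun [set: mpt R] (dist_bd Om : mpt R -> R).
Proof.
apply: measurable_lipschitz => x y.
by rewrite (le_trans (dist_bd_lipschitz Om x y))// lerD2l enorm_le_sum.
Qed.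

Lemma measurable_dist_weight Om alpha (D : set (mpt R)) :
  measurable_fun D (dist_weight Om alpha : mpt R -> R).
Proof.
apply: (measurableT_comp (measurable_powR alpha)).
exact: measurable_funTS (measurable_dist_bd Om).
Qed.

Lemma continuous_pdot a : continuous (pdot a).
Proof.
have -> : pdot a = fun x => a.1.1 * x.1.1 + a.1.2 * x.1.2 + a.2 * x.2.
  by apply/funext => x; rewrite pdotE.
move=> x; apply: cvgD; [apply: cvgD|]; apply: cvgMr.
- by apply: (@cvg_comp _ _ _ fst fst); exact: cvg_fst.
- by apply: (@cvg_comp _ _ _ fst snd); [exact: cvg_fst|exact: cvg_snd].
- exact: cvg_snd.
Qed.

Lemma measurable_pdot a : measurable_fun [set: mpt R] (pdot a : mpt R -> R).
Proof.
have -> : pdot a = fun x => a.1.1 * x.1.1 + a.1.2 * x.1.2 + a.2 * x.2.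
  by apply/funext => x; rewrite pdotE.
have m1 : measurable_fun [set: mpt R] (fun x : mpt R => x.1) by exact: measurable_fst.
have m11 := measurableT_comp (@measurable_fst _ _ (measurableTypeR R) (measurableTypeR R)) m1.
have m12 := measurableT_comp (@measurable_snd _ _ (measurableTypeR R) (measurableTypeR R)) m1.
have m2 : measurable_fun [set: mpt R] (fun x : mpt R => x.2) by exact: measurable_snd.
have mc (c : R) : measurable_fun [set: mpt R] (fun _ : mpt R => c).
  exact: measurable_cst.
have mM c := measurable_funM (mc c).
exact: (measurable_funD (measurable_funD (mM _ _ m11) (mM _ _ m12)) (mM _ _ m2)).
Qed.
End euclidean.

(** * Bounded sets cut out by finitely many linear inequalities *)

Section polyhedron.
Variables (R : realType) (n : nat) (a : 'I_n -> pt R) (b : 'I_n -> R).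
Implicit Types (x y : pt R).
Local Notation Om := [set x | forall l, pdot (a l) x < b l].
Hypotheses (Om0 : Om !=set0) (Om_bounded : bounded_set Om).

Let Om_open : open Om.
Proof.
rewrite openE => x Omx.
apply: (@filter_forall _ 'I_n (fun l y => pdot (a l) y < b l) (nbhs x)) => l.
have := lt_nbhsl (Omx l); exact: continuous_pdot.
Qed.

Lemma polyhedron_measurable : measurable (Om : set (mpt R)).
Proof.
have -> : (Om : set (mpt R)) = \bigcap_(l in [set: 'I_n]) (pdot (a l) @^-1` `]-oo, b l[).
  apply/seteqP; split => x /= h l; first by rewrite /= in_itv/= => _; exact: h.
  by have := h l I; rewrite /= in_itv.
apply: fin_bigcap_measurable => // l _; rewrite -[X in measurable X]setTI.
by apply: (measurable_pdot (a l)) => //; exact: measurable_itv.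
Qed.

Lemma polyhedron_cube : exists2 N : R, 0 <= N & Om `<=` cube N.
Proof.
have [M [_ /(_ (Num.max M 0 + 1))]] := Om_bounded.
have h : M < Num.max M 0 + 1 by rewrite ltr_pwDr// le_max lexx.
move=> /(_ h) OmM; exists (Num.max M 0 + 1).
  by rewrite addr_ge0// le_max lexx orbT.
move=> x /OmM; rewrite /= /Num.norm/= !ge_max/=.
by move=> /andP[/andP[]].
Qed.

Lemma polyhedron_boundaryP y : boundary Om y -> exists l, b l <= pdot (a l) y.
Proof.
move=> [_]; rewrite (proj1 (interior_id Om))// => /existsNP[l]; exists l.
by rewrite leNgt; apply/negP.
Qed.

(** With empty boundary the set would be open and closed. So would its trace on a line through one
    of its points, which by connectedness would be the whole line, against boundedness. *)
Lemma polyhedron_boundary_neq0 : boundary Om !=set0.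
Proof.
apply/set0P/eqP => bd0; have [x0 Omx0] := Om0.
pose path (t : R) : pt R := (x0.1.1 + t, x0.1.2, x0.2).
have cpath : continuous path.
  move=> t.
  have c1 : (fun s : R => x0.1.1 + s) @ t --> x0.1.1 + t.
    by apply: cvgD; [exact: cvg_cst | exact: cvg_id].
  have c2 : (fun _ : R => x0.1.2) @ t --> x0.1.2 by exact: cvg_cst.
  have c3 : (fun _ : R => x0.2) @ t --> x0.2 by exact: cvg_cst.
  exact: (cvg_pair (cvg_pair c1 c2) c3).
have clOm : closed Om.
  move=> y cly; apply: contrapT => Omy.
  suff : boundary Om y by rewrite bd0.
  by split => // /interior_subset.
have cR : connected [set: R] by apply/connected_intervalP => x y _ _ z _.
have : path @^-1` Om = setT.
  apply: cR.
  - exists 0 => l; rewrite (_ : path 0 = x0); first exact: Omx0.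
    by rewrite /path addr0 -!surjective_pairing.
  - by exists (path @^-1` Om); [exact: open_comp|rewrite setTI].
  - by exists (path @^-1` Om); [exact: closed_comp|rewrite setTI].
have [N N0 OmN] := polyhedron_cube.
move=> /seteqP[_ /(_ (N + 1 - x0.1.1) I)] /OmN[/= + _ _].
by rewrite addrC subrK ger0_norm ?addr_ge0// gerDl ler10.
Qed.

(** A boundary point $y$ violates some constraint $l$, so the slack of that constraint at $x$ is at
    most $a_l\cdot(y-x)$. Summing all norms makes [B] independent of $l$, and the added 1 makes it
    positive. *)
Let inner_distance : exists2 B : R, 0 < B &
  forall x y, Om x -> boundary Om y -> exists l,
    a l != 0 /\ b l - pdot (a l) x <= B * enorm (x - y).
Proof.
exists (1 + \sum_l enorm (a l)).
  by rewrite ltr_pwDl// sumr_ge0// => l _; exact: enorm_ge0.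
move=> x y Omx /polyhedron_boundaryP[l bl]; exists l; split.
  apply: contraTneq (lt_le_trans (Omx l) bl) => ->.
  by rewrite !pdotE !mul0r ltxx.
have h : b l - pdot (a l) x <= enorm (a l) * enorm (x - y).
  apply: (@le_trans _ _ (pdot (a l) (y - x))); first by rewrite pdotBr lerD2r.
  by rewrite (enormC x) pdot_le_enorm.
rewrite (le_trans h)// ler_wpM2r ?enorm_ge0//.
rewrite (bigD1 l)//= addrCA lerDl addr_ge0// sumr_ge0// => i _.
exact: enorm_ge0.
Qed.

Lemma dist_bd_gt0 x : Om x -> 0 < dist_bd Om x.
Proof.
move=> Omx; have [B B0 BP] := inner_distance.
have [z bz] := polyhedron_boundary_neq0.
have [e e0 eP] : exists2 e : R, 0 < e & forall l, e <= b l - pdot (a l) x.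
  (* The smallest slack at [x], capped at 1 so as to be positive over an empty family of constraints
     too. *)
  exists (\big[Num.min/1]_l (b l - pdot (a l) x)).
    apply/bigmin_gtP; split; first exact: ltr01.
    by move=> l _; rewrite subr_gt0; exact: Omx.
  by move=> l; exact: bigmin_le_cond.
apply: (@lt_le_trans _ _ (e / B)); first by rewrite divr_gt0.
apply: lb_le_inf; first by exists (enorm (x - z)); exists z.
move=> _ [y by_ <-]; have [l [_ h]] := BP _ _ Omx by_.
by rewrite ler_pdivrMr// mulrC (le_trans (eP l)).
Qed.

Lemma mu3_dist_bd : exists2 C : R, 0 <= C & forall r : R, 0 < r ->
  (mu3 R (Om `&` [set x | (dist_bd Om x <= r)%R]) <= (C * r)%:E)%E.
Proof.
have [B B0 BP] := inner_distance.
have [N N0 OmN] := polyhedron_cube.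
have mslab l (r : R) :
    measurable (Om `&` [set x | b l - pdot (a l) x <= r] : set (mpt R)).
  apply: measurableI; first exact: polyhedron_measurable.
  rewrite -[X in measurable X]setTI (_ : [set _ | _] =
    (pdot (a l) : mpt R -> R) @^-1` `[b l - r, +oo[).
    by apply: (measurable_pdot (a l)) => //; exact: measurable_itv.
  by apply/seteqP; split => x /=; rewrite in_itv/= andbT; lra.
have slab l : exists K : R, 0 <= K /\ (a l != 0 -> forall r : R, 0 < r ->
    (mu3 R (Om `&` [set x | (b l - pdot (a l) x <= r)%R]) <= (K * r)%:E)%E).
  have [a0|a0] := eqVneq (a l) 0; first by exists 0; rewrite lexx.
  have [K K0 KP] := mu3_slab a0 N0; exists K; split => // _ r r0.
  apply: KP => //; first exact: ltW.
  - by move=> x [/OmN].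
  - move=> x y [/(_ l) h1 /= h2] [/(_ l) h3 /= h4].
    by rewrite ler_norml; apply/andP; split; lra.
pose K l := projT1 (cid (slab l)).
have K0 l : 0 <= K l by rewrite /K; case: cid => ? /= [].
have KP l : a l != 0 -> forall r : R, 0 < r ->
    (mu3 R (Om `&` [set x | (b l - pdot (a l) x <= r)%R]) <= (K l * r)%:E)%E.
  by rewrite /K; case: cid => ? /= [].
exists (\sum_l K l * (B * 2)).
  by apply: sumr_ge0 => l _; rewrite !mulr_ge0// ltW.
move=> r r0; have Br0 : 0 < B * (2 * r) by rewrite !mulr_gt0.
(* Constraints with zero normal get the empty set; [inner_distance] always returns a nonzero normal,
   so the sets still cover the layer. *)
pose S l : set (mpt R) := if a l == 0 then set0 else
  Om `&` [set x | b l - pdot (a l) x <= B * (2 * r)].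
have mS l : measurable (S l) by rewrite /S; case: ifPn.
pose F k := if insub k is Some l then S l else set0.
have FS (l : 'I_n) : F l = S l by rewrite /F valK.
have mOr : measurable (Om `&` [set x | dist_bd Om x <= r] : set (mpt R)).
  apply: measurableI; first exact: polyhedron_measurable.
  rewrite -[X in measurable X]setTI (_ : [set _ | _] =
    (dist_bd Om : mpt R -> R) @^-1` `]-oo, r]).
    by apply: (measurable_dist_bd Om) => //; exact: measurable_itv.
  by apply/seteqP; split => x /=; rewrite in_itv.
apply: (@le_trans _ _ (\sum_(k < n) mu3 R (F k))%E).
  apply: content_subadditive => //.
    by move=> k kn; have := FS (Ordinal kn) => /= ->.
  move=> x [Omx /= xr].
  have [z bz] := polyhedron_boundary_neq0.
  have hE : has_inf [set enorm (x - y) | y in boundary Om].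
    split; first by exists (enorm (x - z)); exists z.
    by exists 0 => _ [y _ <-]; exact: enorm_ge0.
  (* A boundary point within $2r$ is obtained from the infimum up to an error [r], hence slabs of
     width $2Br$. *)
  have [_ [y by_ <-] ye] := inf_adherent r0 hE.
  have {}ye : enorm (x - y) <= 2 * r.
    by move: ye xr; rewrite /dist_bd; lra.
  have [l [al hl]] := BP _ _ Omx by_.
  rewrite -bigcup_mkord; exists l; first exact: ltn_ord.
  rewrite FS /S (negbTE al); split => //=.
  by rewrite (le_trans hl)// ler_wpM2l// ltW.
rewrite mulr_suml -sumEFin; apply: lee_sum => l _; rewrite FS /S.
case: ifPn => al.
  by rewrite measure0 lee_fin !mulr_ge0// ltW.
by rewrite (le_trans (KP l al _ Br0))// lee_fin !mulrA.
Qed.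
End polyhedron.

(** * Integrability of powers of the distance *)

(** For $t<1$ let $k+1$ be the least exponent with $2^{-(k+1)}<t$. Minimality gives $t\le 2^{-k}$,
    and the negative power reverses the strict inequality. *)
Lemma dyadic_layer (R : realType) (alpha t : R) : alpha < 0 -> 0 < t ->
  t `^ alpha <= 1 \/
  exists k, t <= 2^-1 ^+ k /\ t `^ alpha <= (2^-1 ^+ k.+1) `^ alpha.
Proof.
move=> a0 t0.
have anti s : 0 < s -> s <= t -> t `^ alpha <= s `^ alpha.
  move=> s0 st; rewrite -[alpha]opprK !(powRN _ (- alpha)).
  rewrite lef_pV2 ?posrE ?powR_gt0//.
  by apply: ge0_ler_powR; rewrite ?nnegrE ?oppr_ge0// ltW.
have [t1|t1] := leP 1 t; first by left; have := anti 1 ltr01 t1; rewrite powR1.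
have exn : exists n, 2^-1 ^+ n < t.
  have ti0 : 0 < t^-1 by rewrite invr_gt0.
  have := archi_boundP (ltW ti0).
  set n := Num.bound _ => tn; exists n; rewrite exprVn.
  rewrite -[t]invrK ltf_pV2 ?posrE ?exprn_gt0 ?invr_gt0//.
  by rewrite (lt_trans tn)// -natrX ltr_nat ltn_expl.
right; case: (ex_minnP exn) => -[|k] kt kmin.
  by rewrite expr0 ltNge (ltW t1) in kt.
exists k; split; last by rewrite anti ?exprn_gt0 ?invr_gt0// ltW.
by rewrite leNgt; apply/negP => /kmin; rewrite ltnn.
Qed.

(** The layer $t\le 2^{-k}$, weighted by $2^{-(k+1)\alpha}$, contributes at most $C2^{-\alpha}z^k$
    with $z=2^{-(1+\alpha)}$. This is a convergent geometric series because $\alpha>-1$. *)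
Lemma singular_power_integrable d (T : measurableType d) (R : realType)
    (nu : {measure set T -> \bar R}) (D : set T) (t : T -> R) (alpha C : R) :
  measurable D -> (nu D < +oo)%E -> measurable_fun D t ->
  (forall x, D x -> 0 < t x) -> -1 < alpha -> alpha < 0 -> 0 <= C ->
  (forall r, 0 < r -> (nu (D `&` [set x | (t x <= r)%R]) <= (C * r)%:E)%E) ->
  Rintegrable nu D (fun x => t x `^ alpha).
Proof.
move=> mD nuD mt t0 a1 a0 C0 tC.
pose S k := D `&` [set x | t x <= 2^-1 ^+ k].
pose c k : R := (2^-1 ^+ k.+1) `^ alpha.
have mS k : measurable (S k).
  rewrite /S (_ : [set _ | _] = t @^-1` `]-oo, 2^-1 ^+ k]).
    by apply: mt => //; exact: measurable_itv.
  by apply/seteqP; split => x /=; rewrite in_itv.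
have c0 k : 0 <= c k by rewrite powR_ge0.
pose F k x := (c k * \1_(S k) x)%:E.
have mF k : measurable_fun D (F k).
  apply/measurable_EFinP; apply: measurable_funM; first exact: measurable_cst.
  exact: measurable_indic.
have F0 k x : D x -> (0 <= F k x)%E by move=> _; rewrite lee_fin mulr_ge0.
pose z : R := 2^-1 `^ (1 + alpha).
have z1 : z < 1.
  have zle : z <= 1.
    rewrite -(powRr0 (2^-1 : R)); apply: ger_powR; last by lra.
    by apply/andP; split; lra.
  rewrite lt_neqAle zle andbT /z powR_eq1 !negb_or.
  apply/and3P; split; first by rewrite lt_eqF//; lra.
    by rewrite -leNgt; lra.
  by rewrite gt_eqF//; lra.
have z0 : 0 < z by rewrite powR_gt0// invr_gt0.
have intF k : (\int[nu]_(x in D) F k x <= (C * 2^-1 `^ alpha * z ^+ k)%:E)%E.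
  under eq_integral do rewrite /F EFinM.
  rewrite ge0_integralZl//; last 2 first.
    by apply/measurable_EFinP; exact: measurable_indic.
    by rewrite lee_fin.
  rewrite integral_indic// (_ : S k `&` D = S k); last first.
    by rewrite /S setIAC setIid.
  apply: le_trans (lee_wpmul2l _ (tC (2^-1 ^+ k) _)) _; first by rewrite lee_fin.
    by rewrite exprn_gt0// invr_gt0.
  rewrite -EFinM lee_fin le_eqVlt; apply/orP; left; apply/eqP.
  have pw n : (2^-1 ^+ n) `^ alpha = (2^-1 `^ alpha) ^+ n :> R.
    have h0 : 0 <= 2^-1 :> R by rewrite invr_ge0.
    by rewrite -(powR_mulrn n h0) -(powR_mulrn n (powR_ge0 _ _)) powRAC.
  have -> : z = 2^-1 * 2^-1 `^ alpha.
    rewrite /z powRD ?powRr1 ?invr_ge0//.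
    by apply/implyP => _; rewrite invr_eq0.
  by rewrite /c pw exprMn exprS; ring.
apply/integrableP; split.
  by apply/measurable_EFinP; apply: (measurableT_comp (measurable_powR alpha)).
apply: (@le_lt_trans _ _
  (\int[nu]_(x in D) (1 + \sum_(0 <= k <oo) F k x))%E).
  have msum : measurable_fun D (fun x => (\sum_(0 <= k <oo) F k x)%E).
    by apply: ge0_emeasurable_sum => // k x Dx _; exact: F0.
  apply: ge0_le_integral => //=.
  - apply/measurable_EFinP; apply: measurableT_comp => //.
    exact: (measurableT_comp (measurable_powR alpha)).
  - by apply: emeasurable_funD => //; exact: measurable_cst.
  move=> x Dx; rewrite ger0_norm ?powR_ge0//.
  have sum0 : (0 <= \sum_(0 <= k <oo) F k x)%E.
    by apply: nneseries_ge0 => k _ _; exact: F0.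
  have [h|[k [h1 h2]]] := dyadic_layer a0 (t0 _ Dx).
    by rewrite -[leLHS]adde0; apply: leeD.
  rewrite -[leLHS]add0e; apply: leeD => //.
  (* The partial sum of length $k+1$ is the first to contain the term of index $k$. *)
  apply: le_trans (nneseries_lim_ge k.+1 _); last by move=> n _ _; exact: F0.
  rewrite big_nat_recr//= -[leLHS]add0e; apply: leeD.
    by apply: sume_ge0 => n _; exact: F0.
  by rewrite /F indicE mem_set ?mulr1 ?lee_fin//; split.
rewrite ge0_integralD//; last 2 first.
- by move=> x Dx; apply: nneseries_ge0 => k _ _; exact: F0.
- by apply: ge0_emeasurable_sum => // k x Dx _; exact: F0.
rewrite integral_cst// mul1e lte_add_pinfty//.
rewrite integral_nneseries//.
apply: le_lt_trans (ltry (C * 2^-1 `^ alpha * (1 - z)^-1)).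
apply: lime_le.
  by apply: is_cvg_nneseries => k _ _; apply: integral_ge0 => x Dx; exact: F0.
apply: nearW => m.
apply: (@le_trans _ _ (\sum_(0 <= k < m) (C * 2^-1 `^ alpha * z ^+ k)%:E)%E).
  by apply: lee_sum => k _; exact: intF.
rewrite sumEFin lee_fin.
apply: (@geometric_le_lim _ m (C * 2^-1 `^ alpha) z) => //.
  by rewrite mulr_ge0 ?powR_ge0.
by rewrite ger0_norm// ltW.
Qed.

(** * The finite element estimate *)

Section lebesgue_spaces.
Variables (R : realType) (Om : set (pt R)).
Hypothesis mOm : measurable (Om : set (mpt R)).
Implicit Types (g w : pt R -> R) (v : vfield R).

Let intg g := Rintegrable (mu3 R) Om g.

Lemma Linf_bounded g : Linf Om g ->
  exists2 B : R, 0 <= B & {ae mu3 R, forall x, Om x -> `|g x| <= B}.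
Proof.
move=> [mg]; rewrite /linfnorm unlock; case: ifPn => [mu0|].
  set s := ess_sup _ _ => sy.
  have ae_s := ess_sup_ge (mu3 R) (abse \o (EFin \o g) \_ Om).
  have [B B0 sB] : exists2 B : R, 0 <= B & (s <= B%:E)%E.
    case: s sy => [r _||] //; last by exists 0; rewrite ?leNye.
    exists `|r| => //; by rewrite lee_fin ler_norm.
  exists B => //; apply: filterS ae_s => x /= xs Omx.
  rewrite -lee_fin; apply: le_trans sB; apply: le_trans xs.
  by rewrite patchE mem_set.
(* The $L^\infty$ norm is 0 by definition if the whole space is null, and then every property holds
   almost everywhere. *)
rewrite -leNgt measure_le0 => /eqP mu0 _; exists 0 => //.
by exists setT; split.
Qed.

Lemma Linf_Lq g q w : Linf Om g -> 0 < q -> intg w -> (forall x, Om x -> 0 <= w x) ->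
  Lq Om q w g.
Proof.
move=> Lg q0 iw w0; have [mg _] := Lg; split=> //.
have [B B0 gB] := Linf_bounded Lg.
have mw := Rintegrable_measurable iw.
have mgq : measurable_fun (Om : set (mpt R)) (fun x : mpt R => `|g x| `^ q).
  apply: (measurableT_comp (measurable_powR q)); exact: measurableT_comp.
apply: poweR_lty.
have /integrableP[_] := RintegrableZ mOm (B `^ q) iw.
apply: le_lt_trans; apply: ae_ge0_le_integral => //.
- by move=> x Omx; rewrite lee_fin mulr_ge0 ?powR_ge0 ?w0.
- by apply/measurable_EFinP; exact: measurable_funM.
- apply: measurableT_comp => //; apply/measurable_EFinP.
  by apply: measurable_funM => //; exact: measurable_cst.
apply: (@filterS _ _ (ae_filter_ringOfSetsType (mu3 R)) _ _ _ gB) => x xB Omx /=.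
rewrite lee_fin (le_trans _ (ler_norm _))// ler_wpM2r ?w0//.
by apply: ge0_ler_powR; rewrite ?nnegrE ?(ltW q0)// xB.
Qed.

Lemma Lq_Rintegrable g q w : measurable_fun (Om : set (mpt R)) (w : mpt R -> R) ->
  (forall x, Om x -> 0 <= w x) -> 0 < q -> Lq Om q w g ->
  intg (fun x => `|g x| `^ q * w x).
Proof.
move=> mw w0 q0 [mg gq]; apply: Rintegrable_powR => //.
by apply: (measurableT_comp (measurable_powR q)); exact: measurableT_comp.
Qed.

Lemma measurable_one_w : measurable_fun (Om : set (mpt R)) (one_w : mpt R -> R).
Proof. exact: measurable_cst. Qed.

Lemma L2_Rintegrable g : Lq Om 2 one_w g -> intg (fun x => g x ^+ 2).
Proof.
move=> L2; have := Lq_Rintegrable measurable_one_w _ _ L2.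
move=> h; apply: eq_Rintegrable (h _ _) => // x _.
by rewrite mulr1 powR_mulrn// real_normK ?num_real.
Qed.

Lemma Lq_L23 w g : measurable_fun (Om : set (mpt R)) (w : mpt R -> R) ->
  (forall x, Om x -> 0 <= w x) -> Lq Om 2 one_w g -> Lq Om 3 w g ->
  L23 (mu3 R) Om w g.
Proof.
move=> mw w0 L2 L3; split; [by case: L2|exact: L2_Rintegrable|].
apply: (eq_Rintegrable mOm _ (Lq_Rintegrable mw w0 _ L3)) => // x _.
by rewrite powR_mulrn// mulrC.
Qed.

Lemma Lq0_zero q w : 0 < q -> Lq0 Om q w (fun=> 0).
Proof.
move=> q0; have z (r : R) : 0 < r -> forall w', Lq Om r w' (fun=> 0).
  move=> r0 w'; split; first exact: measurable_cst.
  apply: poweR_lty; rewrite integral0_eq// => x _.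
  by rewrite normr0 powR0 ?mul0r// gt_eqF.
split; [exact: z|exact: z|].
by rewrite /Rintegral integral0_eq.
Qed.

Lemma tnorm_sqr (F : pt R -> mat R) : intg (fun x => mnorm (F x) ^+ 2) ->
  (tnorm Om 2 one_w F ^+ 2 = (\int[mu3 R]_(x in Om) (mnorm (F x) ^+ 2))%R%:E)%E.
Proof.
move=> iF; rewrite /tnorm /lnorm.
have -> : (\int[mu3 R]_(x in Om) (`|mnorm (F x)| `^ 2 * one_w x)%:E)%E =
    (\int[mu3 R]_(x in Om) (mnorm (F x) ^+ 2))%R%:E.
  rewrite fineK ?integrable_fin_num//; apply: eq_integral => x _.
  by rewrite mulr1 powR_mulrn// ger0_norm ?mnorm_ge0.
rewrite poweR_EFin -EFin_expe -powR_mulrn ?powR_ge0// -powRrM.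
by rewrite mulVf// powRr1// Rintegral_ge0// => x _; rewrite sqr_ge0.
Qed.

Lemma tnorm_cube w (F : pt R -> mat R) :
  intg (fun x => w x * mnorm (F x) ^+ 3) ->
  tnorm Om 3 w F =
    ((\int[mu3 R]_(x in Om) (w x * mnorm (F x) ^+ 3)) `^ 3^-1)%:E.
Proof.
move=> iF; rewrite /tnorm /lnorm.
have -> : (\int[mu3 R]_(x in Om) (`|mnorm (F x)| `^ 3 * w x)%:E)%E =
    (\int[mu3 R]_(x in Om) (w x * mnorm (F x) ^+ 3))%R%:E.
  rewrite fineK ?integrable_fin_num//; apply: eq_integral => x _.
  by rewrite mulrC powR_mulrn// ger0_norm ?mnorm_ge0.
by rewrite poweR_EFin.
Qed.

End lebesgue_spaces.

(** For $\alpha<0$ the weight is integrable by the layer estimate; for $\alpha\ge0$ it is bounded,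
    the distance to one boundary point being bounded on the polyhedron. *)
Lemma polyhedron_data (R : realType) (Om : set (pt R)) (alpha : R) :
  convex_polyhedron Om -> -1 < alpha ->
  [/\ measurable (Om : set (mpt R)), (mu3 R Om < +oo)%E,
      forall x, Om x -> 0 < dist_weight Om alpha x &
      Rintegrable (mu3 R) Om (dist_weight Om alpha)].
Proof.
move=> [Om0 bOm [n [a [b E]]]] alpha1; subst Om.
have mOm := polyhedron_measurable a b.
have [N N0 OmN] := polyhedron_cube bOm.
have muOm : (mu3 R [set x | forall l, (pdot (a l) x < b l)%R] < +oo)%E.
  exact: mu3_cube_lty N0 mOm OmN.
have pos x := dist_bd_gt0 Om0 bOm (x := x).
split => //; first by move=> x /pos h; rewrite powR_gt0.
have [alpha0|alpha0] := ltP alpha 0.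
  have [C C0 CP] := mu3_dist_bd Om0 bOm.
  apply: (singular_power_integrable (C := C)) => //.
  exact: measurable_funTS (measurable_dist_bd _).
have [z bz] := polyhedron_boundary_neq0 Om0 bOm.
set Om : set (mpt R) := [set x | _] in mOm muOm pos bz *.
pose B := N + N + N + enorm z.
have B0 : 0 <= B by rewrite !addr_ge0 ?enorm_ge0.
have dB x : Om x -> dist_bd Om x <= B.
  move=> Omx; apply: (le_trans (dist_bd_le x bz)).
  apply: (le_trans (enorm_triangle x 0 z)).
  rewrite sub0r addrC subr0 lerD//.
    have [h1 h2 h3] := OmN _ Omx.
    by rewrite (le_trans (enorm_le_sum _))//; lra.
  by rewrite -[- z]sub0r enormC subr0.
have iB : Rintegrable (mu3 R) Om (cst (B `^ alpha)).
  apply/integrableP; split; first by apply/measurable_EFinP; exact: measurable_cst.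
  rewrite (_ : (fun x => _) = cst `|(B `^ alpha)%:E|%E)//.
  by rewrite integral_cst// lte_mul_pinfty.
apply: (Rintegrable_le mOm _ iB); first exact: measurable_dist_weight.
move=> x Omx; rewrite ger0_norm ?powR_ge0//.
by apply: ge0_ler_powR; rewrite ?nnegrE ?dist_bd_ge0// dB.
Qed.

(** * A priori bound and Galerkin argument *)

Section smagorinsky_errors.
Variables (R : realType) (Om : set (pt R)) (mu muNL alpha : R) (f : pt R -> mat R).
Hypotheses (mOm : measurable (Om : set (mpt R))) (mu0 : 0 < mu) (muNL0 : 0 < muNL).
Let w : pt R -> R := dist_weight Om alpha.
Hypotheses (w_gt0 : forall x, Om x -> 0 < w x)
           (iw : Rintegrable (mu3 R) Om w) (i1 : Rintegrable (mu3 R) Om one_w).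
Implicit Types (v u : vfield R) (p r : pt R -> R).

Local Notation X3 := (Xspace Om 3 w).
Local Notation M3 := (Mspace Om 3 w).
Local Notation mL23 := (mL23 (mu3 R) Om w).
Local Notation intg g := (Rintegrable (mu3 R) Om g).

Let mw : measurable_fun (Om : set (mpt R)) (w : mpt R -> R).
Proof. exact: measurable_dist_weight. Qed.

Let w_ge0 x : Om x -> 0 <= w x. Proof. by move=> /w_gt0/ltW. Qed.

Let conj3_gt0 : 0 < conj_exp (3 : R).
Proof. by rewrite /conj_exp divr_gt0//; lra. Qed.

(** Makes discrete velocities admissible in the continuous problem; integrability of the weight puts
    bounded gradients in $L^3(\omega_\alpha)$. *)
Lemma W1inf_0_Xspace v : W1inf_0 Om v -> X3 v.
Proof.
move=> [v0 vi gi]; have one0 x : Om x -> 0 <= one_w x :> R by [].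
split; split => //.
- by move=> i j; rewrite (ord1 i); apply: Linf_Lq.
- by move=> i j; apply: Linf_Lq.
- by move=> i j; rewrite (ord1 i); apply: Linf_Lq.
- by move=> i j; apply: Linf_Lq.
Qed.

Lemma Xspace_eps v : X3 v -> mL23 (eps v).
Proof.
move=> [[_ _ g2] [_ _ g3]]; apply: mL23_sym => // i j; exact: Lq_L23.
Qed.

Lemma div_eps v x : div v x = \tr (eps v x).
Proof. by rewrite /eps trace_sym. Qed.

Lemma Lq0_Mspace r : Lq0 Om 2 one_w r -> M3 r.
Proof.
move=> Lr; exists r, (fun=> 0); split => //; first exact: Lq0_zero.
by move=> x _; rewrite addr0.
Qed.

Lemma Mspace_split p : M3 p -> exists q1 q2 : pt R -> R,
  [/\ measurable_fun (Om : set (mpt R)) (q1 : mpt R -> R),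
      measurable_fun (Om : set (mpt R)) (q2 : mpt R -> R),
      intg (fun x => q1 x ^+ 2),
      intg (fun x => `|q2 x| `^ conj_exp 3 * w x `^ (1 - 3)^-1) &
      forall x, Om x -> p x = q1 x + q2 x].
Proof.
move=> [q1 [q2 [[L1 _ _] [L2 _ _] pq]]]; exists q1, q2.
have [m1 _] := L1; have [m2 _] := L2.
split => //; first exact: L2_Rintegrable.
apply: Lq_Rintegrable => //.
- exact: (measurableT_comp (measurable_powR _) mw).
- by move=> x Omx; rewrite /dual_weight powR_ge0.
Qed.

Lemma pressure_div_int p v : M3 p -> X3 v -> intg (fun x => p x * div v x).
Proof.
move=> /Mspace_split[q1 [q2 [m1 m2 i2 i3 pq]]] /Xspace_eps Lv.
apply: (eq_Rintegrable mOm _ (pressure_int mOm mw w_gt0 m1 m2 i2 i3 Lv)).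
by move=> x Omx; rewrite pq// div_eps.
Qed.

Local Notation J := (fun a b => \int[mu3 R]_(x in Om)
  mdot (smag mu muNL (w x) (a x)) (b x)).

(** The condition on [v] is the energy identity without pressure, which holds for $u$ and for every
    $u_h$. The continuous momentum equation of [u0] tested with [v] replaces the load. *)
Lemma smagorinsky_apriori u0 p0 : smagorinsky_sol Om mu muNL alpha f X3 M3 u0 p0 ->
  exists2 K : R, 0 <= K & forall v, X3 v ->
    J (eps v) (eps v) = \int[mu3 R]_(x in Om) mdot (f x) (vgrad v x) ->
    \int[mu3 R]_(x in Om) (w x * mnorm (eps v x) ^+ 3) <= K.
Proof.
move=> [Xu0 Mp0 momentum _].
have [q1 [q2 [m1 m2 i2 i3 pq]]] := Mspace_split Mp0.
have [K K0 KP] := smag_energy_bound mOm mw w_gt0 mu0 muNL0 (Xspace_eps Xu0)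
  m1 m2 i2 i3.
exists K => // v Xv E; apply: KP; first exact: Xspace_eps.
rewrite E -(momentum v Xv); congr (_ - _); apply: eq_Rintegral => x /set_mem Omx.
by rewrite pq// div_eps.
Qed.

(** [C] precedes the discrete spaces, hence is uniform in $h$. Closure under differences is stated
    for gradients, through which velocities enter the equations. *)
Lemma smagorinsky_quasi_optimal K : 0 <= K -> exists2 C : R, 0 < C &
  forall (Xh : set (vfield R)) (Mh : set (pt R -> R)),
    Xh `<=` X3 -> Mh `<=` Lq0 Om 2 one_w ->
    (forall v v', Xh v -> Xh v' -> exists2 z, Xh z &
      forall x, vgrad z x = vgrad v x - vgrad v' x) ->
  forall u p uh ph Uh Ph,
    smagorinsky_sol Om mu muNL alpha f X3 M3 u p ->
    smagorinsky_sol Om mu muNL alpha f Xh Mh uh ph ->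
    stokes_projection Om mu Xh Mh u p Uh Ph ->
    \int[mu3 R]_(x in Om) (w x * mnorm (eps u x) ^+ 3) <= K ->
    \int[mu3 R]_(x in Om) (w x * mnorm (eps uh x) ^+ 3) <= K ->
  \int[mu3 R]_(x in Om) (mnorm (eps u x - eps uh x) ^+ 2) +
  \int[mu3 R]_(x in Om) (w x * mnorm (eps u x - eps uh x) ^+ 3) <=
  C * (\int[mu3 R]_(x in Om) (mnorm (eps u x - eps Uh x) ^+ 2) +
    Num.sqrt (\int[mu3 R]_(x in Om) (w x * mnorm (eps u x - eps Uh x) ^+ 3))).
Proof.
move=> K0; have [C C0 CP] := smag_error_bound (mu3 R) mOm mw w_gt0 mu0 muNL0 K0.
exists C => // Xh Mh XhX Mh2 XhB u p uh ph Uh Ph [Xu Mp mom inc] [Xuh Mph momh inch].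
move=> [XUh MPh proj incP] uK uhK.
have [z Xz gz] := XhB _ _ XUh Xuh; have X3z := XhX _ Xz.
apply: CP => //; [exact: Xspace_eps|exact/Xspace_eps/XhX|exact/Xspace_eps/XhX|].
have ez x : eps Uh x - eps uh x = eps z x by rewrite /eps gz symB.
have pdi r v : Mh r -> X3 v -> intg (fun x => r x * div v x).
  by move=> /Mh2/Lq0_Mspace; exact: pressure_div_int.
have idr r v : Mh r -> X3 v -> intg (fun x => div v x * r x).
  move=> Mr Xv; apply: eq_Rintegrable (pdi _ _ Mr Xv) => // x _; exact: mulrC.
(* $z=U_h-u_h$ is discretely divergence free: $u_h$ is by its own constraint, and $U_h$ is because
   the Stokes projection preserves the divergence of $u$ tested against $M_h$. *)
have divz r : Mh r -> \int[mu3 R]_(x in Om) (r x * div z x) = 0.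
  move=> Mr; have := incP _ Mr.
  under eq_Rintegral do rewrite mulrBl.
  have iu := idr _ _ Mr Xu; have iU := idr _ _ Mr (XhX _ XUh).
  have iuh := idr _ _ Mr (XhX _ Xuh).
  rewrite RintegralB// (inc _ (Lq0_Mspace (Mh2 _ Mr))) sub0r => /eqP.
  rewrite oppr_eq0 => /eqP hU.
  under eq_Rintegral do rewrite mulrC /div gz raddfB/= mulrBl.
  by rewrite RintegralB// hU (inch _ Mr) subrr.
under eq_Rintegral do rewrite ez.
under [X in _ - X = _]eq_Rintegral do rewrite ez.
under [X in _ = _ * X]eq_Rintegral do rewrite ez.
have pz : \int[mu3 R]_(x in Om) ((p x - Ph x) * div z x) =
    \int[mu3 R]_(x in Om) (p x * div z x).
  under eq_Rintegral do rewrite mulrBl.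
  rewrite (RintegralB mOm (pressure_div_int Mp X3z) (pdi _ _ MPh X3z)).
  by rewrite (divz _ MPh) subr0.
have := mom _ X3z; have := momh _ Xz; have := proj _ Xz.
rewrite pz (divz _ Mph).
(* The discrete pressures are gone, and the term [P] in the continuous pressure occurs both in the
   momentum equation and in the projection, so it cancels. *)
have cancel (A P F S1 S2 : R) :
  2 * mu * A - P = 0 -> S1 - 0 = F -> S2 - P = F -> S2 - S1 = 2 * mu * A.
  move=> /subr0_eq -> S1F FE; rewrite subr0 in S1F.
  by rewrite S1F -FE opprB addrC subrK.
exact: cancel.
Qed.
End smagorinsky_errors.

(** * Assembly of the estimate in terms of norms *)

Theorem corollary6p4 (R : realType)
    (Om : set (pt R)) (Om_poly : convex_polyhedron Om)
    (mu muNL alpha : R) (mu_gt0 : 0 < mu) (muNL_gt0 : 0 < muNL)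
    (alpha_gtN1 : -1 < alpha) (alpha_lt : alpha < 2^-1)
    (H : set R) (T : R -> set (set (pt R)))
    (X : R -> set (vfield R)) (M : R -> set (pt R -> R))
    (Ih : R -> (pt R -> 'rV[R]_3) -> vfield R)
    (XM_fe : fe_discretization Om H T X M Ih)
    (f : pt R -> 'M[R]_3)
    (f_data : sum_space Om (tLq Om 2 one_w)
                (tLq Om (3 / 2) (dist_weight Om (- (alpha / 2)))) f) :
  exists C : R, 0 < C /\
    forall (u : vfield R) (p : pt R -> R),
      smagorinsky_sol Om mu muNL alpha f
        (Xspace Om 3 (dist_weight Om alpha))
        (Mspace Om 3 (dist_weight Om alpha)) u p ->
    forall h : R, H h ->
    forall (uh : vfield R) (ph : pt R -> R),
      smagorinsky_sol Om mu muNL alpha f (X h) (M h) uh ph ->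
    forall (Uh : vfield R) (Ph : pt R -> R),
      stokes_projection Om mu (X h) (M h) u p Uh Ph ->
    (tnorm Om 2 one_w (fun x => (eps u x - eps uh x)%R) ^+ 2 +
     tnorm Om 3 (dist_weight Om alpha) (fun x => (eps u x - eps uh x)%R) ^+ 3
     <= C%:E *
     (tnorm Om 2 one_w (fun x => (eps u x - eps Uh x)%R) ^+ 2 +
      tnorm Om 3 (dist_weight Om alpha) (fun x => (eps u x - eps Uh x)%R)
        `^ (3 / 2)%R))%E.
Proof.
have [mOm muOm w0 iw] := polyhedron_data Om_poly alpha_gtN1.
(* One solution is fixed before $u$, and the constant depends on it instead of on $u$. If there is
   none, the claim is vacuous. *)
have [[u0 [p0 sol0]]|nosol] := pselect (exists u p,
    smagorinsky_sol Om mu muNL alpha f (Xspace Om 3 (dist_weight Om alpha))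
      (Mspace Om 3 (dist_weight Om alpha)) u p); last first.
  by exists 1; split => // u p sol; case: nosol; exists u, p.
have [K K0 KP] := smagorinsky_apriori mOm mu_gt0 muNL_gt0 w0 sol0.
have i1 : Rintegrable (mu3 R) Om one_w.
  apply/integrableP; split; first by apply/measurable_EFinP; exact: measurable_cst.
  rewrite (_ : (fun x => _) = cst `|1%:E|%E)// integral_cst//.
  by rewrite lte_mul_pinfty.
have mw : measurable_fun (Om : set (mpt R)) (dist_weight Om alpha : mpt R -> R).
  exact: measurable_dist_weight.
have w_ge0 x : Om x -> 0 <= dist_weight Om alpha x by move=> /w0/ltW.
have XhX h : H h -> X h `<=` Xspace Om 3 (dist_weight Om alpha).
  have [d XP] := fe_velocity XM_fe; move=> /XP[_ X1 _] v /X1.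
  exact: W1inf_0_Xspace.
have Mh2 h : H h -> M h `<=` Lq0 Om 2 one_w.
  by have [d MP] := fe_pressure XM_fe; move=> /MP[_ M2 _] r /M2[].
have XhB h : H h -> forall v v', X h v -> X h v' -> exists2 z, X h z &
    forall x, vgrad z x = vgrad v x - vgrad v' x.
  have [d XP] := fe_velocity XM_fe; move=> /XP[[n [b ->]] _ _].
  move=> _ _ [c1 _ <-] [c2 _ <-].
  exists (lincomb (fun l => c1 l - c2 l) b).
    by exists (fun l => c1 l - c2 l).
  by move=> x /=; rewrite -sumrB; apply: eq_bigr => l _; rewrite scalerBl.
have [C C0 CP] := smagorinsky_quasi_optimal f mOm mu_gt0 muNL_gt0 w0 K0.
exists C; split => // u p sol h Hh uh ph solh Uh Ph proj.
(* Rewriting with [tnorm_sqr] and [tnorm_cube] directly makes unification compare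
   the numerals 2 and 3 of [R] by computation. *)
have lift (x1 x2 y1 y2 : \bar R) (r1 r2 r3 r4 : R) :
    (x1 ^+ 2 = r1%:E -> x2 = r2%:E -> y1 ^+ 2 = r3%:E -> y2 = r4%:E ->
    (r1 + r2 ^+ 3 <= C * (r3 + r4 `^ (3 / 2)))%R ->
    x1 ^+ 2 + x2 ^+ 3 <= C%:E * (y1 ^+ 2 + y2 `^ (3 / 2)%R))%E.
  move=> -> -> -> -> rle.
  by rewrite -EFin_expe poweR_EFin -!EFinD -EFinM lee_fin.
have [Xu Mp mom inc] := sol; have [Xuh Mph momh inch] := solh.
have XUh : X h Uh by case: proj.
(* Testing with $u$ itself: the pressure term vanishes because $p$ is an admissible test function in
   the divergence constraint. The same holds for $u_h$ and $p_h$ below. *)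
have uK : \int[mu3 R]_(x in Om) (dist_weight Om alpha x * mnorm (eps u x) ^+ 3) <= K.
  apply: KP => //; rewrite -(mom u Xu).
  under [X in _ = _ - X]eq_Rintegral do rewrite mulrC.
  by rewrite inc// subr0.
have uhK : \int[mu3 R]_(x in Om) (dist_weight Om alpha x * mnorm (eps uh x) ^+ 3) <= K.
  apply: KP; first exact: XhX Hh _ Xuh.
  rewrite -(momh uh Xuh).
  under [X in _ = _ - X]eq_Rintegral do rewrite mulrC.
  by rewrite inch// subr0.
have L2 (v v' : vfield R) : Xspace Om 3 (dist_weight Om alpha) v ->
    Xspace Om 3 (dist_weight Om alpha) v' ->
    mL23 (mu3 R) Om (dist_weight Om alpha) (fun x => eps v x - eps v' x).
  by move=> Xv Xv'; apply: mL23B => //; exact: Xspace_eps.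
have Le := L2 _ _ Xu (XhX _ Hh _ Xuh); have LE := L2 _ _ Xu (XhX _ Hh _ XUh).
have cube0 (v : vfield R) : 0 <= \int[mu3 R]_(x in Om)
    (dist_weight Om alpha x * mnorm (eps u x - eps v x) ^+ 3).
  apply: Rintegral_ge0 => x Omx.
  by rewrite mulr_ge0 ?w_ge0 ?exprn_ge0 ?mnorm_ge0.
have e30 := cube0 uh; have E30 := cube0 Uh.
have root (r : R) : 0 <= r -> (r `^ 3^-1) ^+ 3 = r.
  by move=> r0; rewrite -powR_mulrn ?powR_ge0// -powRrM mulVf// powRr1.
have root' (r : R) : 0 <= r -> (r `^ 3^-1) `^ (3 / 2) = Num.sqrt r.
  by move=> r0; rewrite -powRrM -powR12_sqrt//; congr powR; field.
apply: (lift _ _ _ _ _ _ _ _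
  (tnorm_sqr mOm (mnorm_sqr_int mOm mw w0 Le))
  (tnorm_cube mOm (mnorm_cube_int mOm mw w0 Le))
  (tnorm_sqr mOm (mnorm_sqr_int mOm mw w0 LE))
  (tnorm_cube mOm (mnorm_cube_int mOm mw w0 LE))).
rewrite (root _ e30) (root' _ E30).
exact: (CP _ _ (XhX _ Hh) (Mh2 _ Hh) (XhB _ Hh) _ _ _ _ _ _ sol solh proj uK uhK).
Qed.
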